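(* Let $p\ge1$, let $\xi$ be a non-zero Killing vector field on the unit sphere $\mathbb{S}^{2p+1}\subset\mathbb{R}^{2p+2}$ with its canonical metric, and let $F_\xi=\ker(r_\xi-\mathrm{Id})$ be its invariant axis, where $r_\xi$ is the flow of $\xi$. Then $\dim F_\xi=2k$ for some $0\le k\le p$, and there is a Kaluza-Klein metric $G$ on $T\mathbb{S}^{2p+1}$ with $A\equiv1$ for which $\xi$ is a harmonic section if and only if (1) $k\neq p$, i.e. $\dim F_\xi$ is not maximal; and (2) in suitable orthonormal coordinates $(x_1,\dots,x_{2p+2})$ of $\mathbb{R}^{2p+2}$, $\xi=\lambda(-x_2,x_1,\dots,-x_{2p-2k+2},x_{2p-2k+1},0,\dots,0)$ with $\lambda$ a non-zero constant. Suppose (1) and (2) hold. If $k=0$, then $\xi$ is a harmonic section for $G$ (with $A\equiv 1$) with no condition on the function $C$ (except that $G$ must be Riemannian), while $B$ must satisfy $$\lambda^2B'(\lambda^2)+B(\lambda^2)=0;$$ for example, $B(t)=Ke^{-t/\lambda^2}$ or $B(t)=K(1+t)^{-(1+\frac{1}{\lambda^2})}$ ($K>0$) are solutions; moreover $\xi$ is then a harmonic map. If $k\ne0$, one solution is given by $C=0$ and $B(t)=Ke^{-\frac{pt}{\lambda^2(p-k)}}$ ($K>0$); however, $\xi$ is then not a harmonic map.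
   Context: Let $(M,g)$ be a Riemannian manifold with Levi-Civita connection $\nabla$. At $(p,e)\in TM$ the space $T_{(p,e)}TM$ splits into the vertical space (kernel of $d\pi$, $\pi:TM\to M$ the projection) and the horizontal space defined by $\nabla$; each $X\in T_pM$ has a horizontal lift $X^h$ and a vertical lift $X^v$. A Kaluza-Klein metric on $TM$ is a Riemannian metric $G$ such that at $(p,e)$ $$G(X^h,Y^h)=A(|e|^2)g(X,Y),\quad G(X^h,Y^v)=0,\quad G(X^v,Y^v)=B(|e|^2)g(X,Y)+C(|e|^2)g(X,e)g(Y,e),$$ where $A,B,C$ are real $C^2$ functions on $[0,\infty)$, $A>0$, and $B,C$ are such that $G$ is positive definite. A vector field $\sigma$ on $M$ is viewed as a map $\sigma:(M,g)\to(TM,G)$. Its tension field $\tau(\sigma)=\operatorname{trace}\nabla d\sigma$ (computed with the Levi-Civita connections of $g$ and $G$) is decomposed as $\tau(\sigma)=[\tau^h(\sigma)]^h+[\tau^v(\sigma)]^v$ with $\tau^h(\sigma),\tau^v(\sigma)$ vector fields on $M$. $\sigma$ is a harmonic map if $\tau(\sigma)=0$, and a harmonic section if $\tau^v(\sigma)=0$ (equivalently, it is critical for the energy with respect to variations through vector fields). The flow of a Killing field on a unit sphere extends to a one-parameter group of linear isometries of the ambient Euclidean space; $F_\xi$ is the linear subspace of vectors of the ambient space fixed by this whole flow. *)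

(* Defs.v *)
From mathcomp Require Export all_boot all_order all_algebra.
From mathcomp Require Export all_classical all_reals all_analysis.
Export numFieldNormedType.Exports.
Export Order.TTheory GRing.Theory Num.Theory.

Set Implicit Arguments.
Unset Strict Implicit.
Unset Printing Implicit Defensive.

Local Open Scope ring_scope.

Section RiemannianCoordinates.
Context {R : realType}.

Definition dotv (n : nat) (v w : 'rV[R]_n) : R := (v *m w^T) 0 0.

(* A metric in local coordinates: its Gram matrix g_ij as a function of the
   coordinate vector. *)
Definition metric (n : nat) := 'rV[R]_n -> 'M[R]_n.

(* Gamma^k_ij of the Levi-Civita connection of g. *)
Definition christoffel (n : nat) (g : metric n) (u : 'rV[R]_n)
    (k i j : 'I_n) : R :=
  2^-1 * \sum_l invmx (g u) k l *
    ('D_('e_i) (fun v => g v j l) u + 'D_('e_j) (fun v => g v i l) u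
     - 'D_('e_l) (fun v => g v i j) u).

(* Tension field (trace of nabla df) at u of f : (R^m, g) -> (R^n, h). *)
Definition tension (m n : nat) (g : metric m) (h : metric n)
    (f : 'rV[R]_m -> 'rV[R]_n) (u : 'rV[R]_m) : 'rV[R]_n :=
  \row_a \sum_i \sum_j invmx (g u) i j *
    ('D_('e_i) (fun v => 'D_('e_j) (fun w => f w 0 a) v) u
     - \sum_k christoffel g u k i j * 'D_('e_k) (fun v => f v 0 a) u
     + \sum_b \sum_c christoffel h (f u) a b c *
         'D_('e_i) (fun v => f v 0 b) u * 'D_('e_j) (fun v => f v 0 c) u).

(* A point (u, y) of the tangent bundle has induced coordinates row_mx u y.
   For w = (a, b) tangent to the tangent bundle at z = (u, y) one has
   w = a^h + (b^k + Gamma^k_ij(u) a^i y^j)^v. *)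
Definition hpart (n : nat) (w : 'rV[R]_(n + n)) : 'rV[R]_n := lsubmx w.

Definition vpart (n : nat) (g : metric n) (z w : 'rV[R]_(n + n)) : 'rV[R]_n :=
  \row_k (rsubmx w 0 k +
    \sum_i \sum_j christoffel g (lsubmx z) k i j * lsubmx w 0 i * rsubmx z 0 j).

Definition kk_metric (n : nat) (A B C : R -> R) (g : metric n) :
    metric (n + n) := fun z =>
  let u := lsubmx z in
  let y := rsubmx z in
  let gip (v w : 'rV[R]_n) := (v *m g u *m w^T) 0 0 in
  let r := gip y y in
  \matrix_(a, b)
    (A r * gip (hpart 'e_a) (hpart 'e_b)
     + B r * gip (vpart g z 'e_a) (vpart g z 'e_b)
     + C r * gip (vpart g z 'e_a) y * gip (vpart g z 'e_b) y).

Fixpoint class_C (n k : nat) (f : 'rV[R]_n -> R) : Prop :=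
  continuous f /\
  if k is k'.+1 then
    forall i, (forall u, derivable f u 'e_i) /\ class_C k' ('D_('e_i) f)
  else True.

(* f is C^2 on [0, +oo[: there it agrees with a function that is C^2 on some
   ]-eps, +oo[. *)
Definition C2_nonneg (f : R -> R) : Prop :=
  exists eps : R, exists F : R -> R,
    [/\ 0 < eps,
        forall t, 0 <= t -> F t = f t,
        forall t, - eps < t -> derivable F t 1,
        forall t, - eps < t -> derivable (derive1 F) t 1 &
        forall t, - eps < t -> {for t, continuous (derive1 (derive1 F))}].

End RiemannianCoordinates.

Section Sphere.
Context {R : realType} (n : nat).
Implicit Types (x e X V : 'rV[R]_n.+1) (E : 'M[R]_(n, n.+1)).
Implicit Types (u : 'rV[R]_n) (xi : 'rV[R]_n.+1 -> 'rV[R]_n.+1).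

Definition sphere x : Prop := dotv x x = 1.

(* The rows of E form an orthonormal basis of the tangent space at x. *)
Definition frame x E : Prop :=
  [/\ sphere x, E *m E^T = 1%:M & E *m x^T = 0].

(* Inverse stereographic projection from -x, a parametrization of the sphere
   minus -x sending 0 to x. *)
Definition chart x E u : 'rV[R]_n.+1 :=
  (1 + dotv u u)^-1 *: ((1 - dotv u u) *: x + 2 *: (u *m E)).

Definition chart_basis x E u : 'M[R]_(n, n.+1) :=
  \matrix_(i, c) 'D_('e_i) (fun w => chart x E w 0 c) u.

(* The canonical metric (first fundamental form) in a chart. *)
Definition sphere_metric x E : metric n :=
  fun u => chart_basis x E u *m (chart_basis x E u)^T.

(* Components of xi in a chart: for xi tangent,
   xi (chart u) = coord_field u *m chart_basis u. *)
Definition coord_field xi x E u : 'rV[R]_n :=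
  xi (chart x E u) *m (chart_basis x E u)^T *m invmx (sphere_metric x E u).

(* Smooth tangent vector fields on the sphere; only the values of xi on the
   sphere matter. *)
Definition vector_field xi : Prop :=
  (forall x, sphere x -> dotv (xi x) x = 0) /\
  (forall x E, frame x E -> forall c k,
     class_C k (fun u => xi (chart x E u) 0 c)).

(* (L_xi g)_ij = 0 in every chart. *)
Definition killing xi : Prop :=
  vector_field xi /\
  forall x E, frame x E -> forall u (i j : 'I_n),
    let g := sphere_metric x E in
    let s := coord_field xi x E in
    \sum_k (s u 0 k * 'D_('e_k) (fun v => g v i j) u
            + g u k j * 'D_('e_i) (fun v => s v 0 k) u
            + g u i k * 'D_('e_j) (fun v => s v 0 k) u) = 0.

(* A, B, C define a Kaluza-Klein metric on TS^n: G is positive definite at each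
   (x, e), on the vectors X^h + V^v. *)
Definition kaluza_klein (A B C : R -> R) : Prop :=
  [/\ C2_nonneg A, C2_nonneg B, C2_nonneg C,
      forall t, 0 <= t -> 0 < A t &
      forall x e X V, sphere x ->
        dotv e x = 0 -> dotv X x = 0 -> dotv V x = 0 ->
        (X != 0) || (V != 0) ->
        0 < A (dotv e e) * dotv X X + B (dotv e e) * dotv V V
            + C (dotv e e) * dotv V e ^+ 2].

(* xi as a map from the sphere to its tangent bundle. *)
Definition section_map xi x E u : 'rV[R]_(n + n) :=
  row_mx u (coord_field xi x E u).

Definition section_tension (A B C : R -> R) xi x E u : 'rV[R]_(n + n) :=
  let g := sphere_metric x E in
  tension g (kk_metric A B C g) (section_map xi x E) u.

(* The horizontal and vertical components of the tension field at x. Being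
   tensorial, they are read in the charts centred at x, whose coordinate is
   u = 0; the components are relative to the basis chart_basis x E 0 of the
   tangent space at x. *)
Definition tension_h (A B C : R -> R) xi x E : 'rV[R]_n :=
  hpart (section_tension A B C xi x E 0).

Definition tension_v (A B C : R -> R) xi x E : 'rV[R]_n :=
  vpart (sphere_metric x E) (section_map xi x E 0)
    (section_tension A B C xi x E 0).

Definition harmonic_section (A B C : R -> R) xi : Prop :=
  forall x E, frame x E -> tension_v A B C xi x E = 0.

Definition harmonic_map (A B C : R -> R) xi : Prop :=
  forall x E, frame x E ->
    tension_h A B C xi x E = 0 /\ tension_v A B C xi x E = 0.

(* r is the one-parameter group of linear isometries of R^{n+1} extending the
   flow of xi. *)
Definition linear_flow xi (r : R -> 'M[R]_n.+1) : Prop :=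
  [/\ r 0 = 1%:M,
      forall s t, r (s + t) = r s *m r t,
      forall t, r t *m (r t)^T = 1%:M &
      forall x, sphere x -> forall t : R,
        is_derive t (1 : R) (fun s => x *m r s) (xi (x *m r t))].

(* The invariant axis F_xi; the flow r is unique. *)
Definition fixed_space xi (v : 'rV[R]_n.+1) : Prop :=
  exists2 r, linear_flow xi r & forall t, v *m r t = v.

(* y |-> (-y_2, y_1, ..., -y_2m, y_(2m-1), 0, ..., 0), with 0-based indices. *)
Definition std_rotation (m : nat) (y : 'rV[R]_n.+1) : 'rV[R]_n.+1 :=
  \row_i (if (i < m.*2)%N then
            if odd i then y 0 (inord i.-1) else - y 0 (inord i.+1)
          else 0).

(* The change of coordinates x |-> x *m Q is orthogonal. *)
Definition rotation_form (m : nat) (lam : R) xi : Prop :=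
  exists2 Q : 'M[R]_n.+1, Q *m Q^T = 1%:M &
    forall x, sphere x -> xi x *m Q = lam *: std_rotation m (x *m Q).

End Sphere.

(* Main.v *)
(** In the great circle through x in direction e, the Killing equation says that
    the inner product of xi with the unit tangent is constant; this gives
    <xi x, y> + <xi y, x> = 0 for all unit x, y, so that xi x = x W with W
    skew-symmetric, and W splits R^(2p+2) into planes of rotation with speeds
    nu_i.  In the stereographic chart centred at x, with the index of the tension
    field lowered by G, only first derivatives of the Gram matrix of G at one
    point are needed.  With t = |x W|^2 this turns the harmonic section equation
    into
      (- 2p (B + t C) + C' (|x W^2|^2 - t^2) + (C - B') |W|^2 - 2 t C) x W
        = 2 B' x W^3
    for all unit x (B, C and their derivatives being taken at t), and the
    vanishing of the horizontal part of the tension field into x W^2 = - t x.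

    If nu_i <> nu_j, the equation on the sphere of span(f_2i, f_2j) has two
    independent components, which force B' = 0 between nu_i^2 and nu_j^2; at an
    eigenvector of the largest speed nu, with b = nu^2, this leaves
    2p (B + b C) = C (|W|^2 - 2 b) where |W|^2 lies between 2 b and (2p + 2) b,
    contradicting the positivity of B and B + b C.  If only one plane rotates,
    then |W|^2 = 2 b and the equation reads B + b C = 0.  When all the non-zero
    speeds are equal to lambda, W^3 = - lambda^2 W and the equation is scalar. *)

Require Import Defs.
From mathcomp Require Import ring lra zify.

Set Implicit Arguments.
Unset Strict Implicit.
Unset Printing Implicit Defensive.

Local Open Scope ring_scope.

(** * Orthonormal families and skew-symmetric matrices *)

(** The terms of the equation have geometric sources. [-2p] is minus the Ricci constant of the
    sphere, since the rough Laplacian of a Killing field is minus its Ricci image. |W|^2 = - tr(W^2)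
    exceeds the squared norm of the covariant derivative of xi by 2 t. The horizontal part is a
    multiple of the covariant derivative of xi along itself and is a curvature term.

    At the centre of a stereographic chart the conformal factor is 4 and stationary, so the
    Christoffel symbols of the sphere and the correction in the horizontal lift vanish there; only
    the derivative of that correction survives, and it carries the curvature.

    The obstacle is t = 0: B and C are controlled on [0, +oo[ only, so their own derivatives mean
    nothing where xi vanishes. The computation therefore runs with C^2 extensions, and the final
    equation is stated for t > 0 alone, because it is void at a zero of xi.

    For two different speeds the second component disappears at the end points, so B' = 0 is
    obtained in the open interval and reaches the end point by continuity of B'. *)

Section Dot.
Context {R : realType}.
Implicit Types (m n k : nat).

Lemma dotvE n (v w : 'rV[R]_n) : dotv v w = \sum_i v 0 i * w 0 i.
Proof. by rewrite /dotv mxE; apply: eq_bigr => i _; rewrite mxE. Qed.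

Lemma dotvC n (v w : 'rV[R]_n) : dotv v w = dotv w v.
Proof. by rewrite !dotvE; apply: eq_bigr => i _; rewrite mulrC. Qed.

Lemma dotvDl n (u v w : 'rV[R]_n) : dotv (u + v) w = dotv u w + dotv v w.
Proof. by rewrite /dotv mulmxDl mxE. Qed.

Lemma dotvZl n a (u w : 'rV[R]_n) : dotv (a *: u) w = a * dotv u w.
Proof. by rewrite /dotv -scalemxAl mxE. Qed.

Lemma dotvDr n (u v w : 'rV[R]_n) : dotv w (u + v) = dotv w u + dotv w v.
Proof. by rewrite dotvC dotvDl !(dotvC w). Qed.

Lemma dotvZr n a (u w : 'rV[R]_n) : dotv w (a *: u) = a * dotv w u.
Proof. by rewrite dotvC dotvZl dotvC. Qed.

Lemma dotvNl n (u w : 'rV[R]_n) : dotv (- u) w = - dotv u w.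
Proof. by rewrite -scaleN1r dotvZl mulN1r. Qed.

Lemma dotvNr n (u w : 'rV[R]_n) : dotv w (- u) = - dotv w u.
Proof. by rewrite -scaleN1r dotvZr mulN1r. Qed.

Lemma dotv0l n (w : 'rV[R]_n) : dotv 0 w = 0.
Proof. by rewrite -(scale0r 0) dotvZl mul0r. Qed.

Lemma dotv0r n (w : 'rV[R]_n) : dotv w 0 = 0.
Proof. by rewrite dotvC dotv0l. Qed.

Lemma dotv_suml n (I : Type) (r : seq I) (P : pred I) (F : I -> 'rV[R]_n) w :
  dotv (\sum_(i <- r | P i) F i) w = \sum_(i <- r | P i) dotv (F i) w.
Proof.
apply: (big_morph (fun v => dotv v w)); first by move=> u v; exact: dotvDl.
exact: dotv0l.
Qed.

Definition dotv_lin := (dotvDl, dotvDr, dotvZl, dotvZr, dotvNl, dotvNr,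
  dotv0l, dotv0r).

Lemma dotv_mul m n (v : 'rV[R]_m) (A : 'M[R]_(m, n)) (w : 'rV[R]_n) :
  dotv (v *m A) w = dotv v (w *m A^T).
Proof. by rewrite /dotv trmx_mul trmxK mulmxA. Qed.

Lemma mulmx_outer m n (v x : 'rV[R]_m) (y : 'rV[R]_n) :
  v *m (x^T *m y) = dotv v x *: y.
Proof. by rewrite mulmxA [v *m _]mx11_scalar mul_scalar_mx. Qed.

Lemma dotv_ge0 n (v : 'rV[R]_n) : 0 <= dotv v v.
Proof. by rewrite dotvE sumr_ge0// => i _; rewrite -expr2 sqr_ge0. Qed.

Lemma dotv_eq0 n (v : 'rV[R]_n) : (dotv v v == 0) = (v == 0).
Proof.
apply/idP/eqP => [|->]; last by rewrite dotv0l.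
rewrite dotvE psumr_eq0; last by move=> i _; rewrite -expr2 sqr_ge0.
move=> /allP h; apply/rowP => i; rewrite mxE.
by have := h i (mem_index_enum _); rewrite -expr2 sqrf_eq0 => /eqP.
Qed.

Lemma dotv_gt0 n (v : 'rV[R]_n) : (0 < dotv v v) = (v != 0).
Proof. by rewrite lt_def dotv_ge0 andbT dotv_eq0. Qed.

Lemma dotv_delta n (v : 'rV[R]_n) i : dotv v ('e_i) = v 0 i.
Proof.
rewrite dotvE (bigD1 i)//= big1 ?addr0 ?mxE ?eqxx ?mulr1// => j ji.
by rewrite mxE eqxx (negbTE ji) mulr0.
Qed.

Lemma eq_dotv n (v w : 'rV[R]_n) : (forall u, dotv v u = dotv w u) -> v = w.
Proof. by move=> h; apply/rowP => i; rewrite -!dotv_delta. Qed.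

Lemma normalizeP n (v : 'rV[R]_n) : v != 0 ->
  exists c : R, [/\ 0 < c, dotv (c^-1 *: v) (c^-1 *: v) = 1 & v = c *: (c^-1 *: v)].
Proof.
rewrite -dotv_gt0 => h; exists (Num.sqrt (dotv v v)).
have c0 : 0 < Num.sqrt (dotv v v) by rewrite sqrtr_gt0.
split => //; last by rewrite scalerA divff ?scale1r// gt_eqF.
rewrite dotvZl dotvZr -[X in _ * (_ * X)](sqr_sqrtr (ltW h)).
by field; rewrite gt_eqF.
Qed.

Lemma skew_dotv n (W : 'M[R]_n) v w : W^T = - W ->
  dotv (v *m W) w = - dotv v (w *m W).
Proof. by move=> h; rewrite dotv_mul h mulmxN dotvNr. Qed.

Lemma skew_dotvv n (W : 'M[R]_n) v : W^T = - W -> dotv (v *m W) v = 0.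
Proof.
move=> h; apply/eqP; rewrite -[_ == _](mulrn_eq0 _ 2) mulr2n.
by rewrite {1}(skew_dotv _ _ h) dotvC addNr.
Qed.

(** Indexing by [nat] lets families be shifted, prolonged and read in pairs 2i, 2i+1 without casts
    between ordinals. *)
Definition orthonormal_family n k (f : nat -> 'rV[R]_n) :=
  forall i j, (i < k)%N -> (j < k)%N -> dotv (f i) (f j) = (i == j)%:R.

Definition family_mx n k (f : nat -> 'rV[R]_n) : 'M[R]_(k, n) := \matrix_i f i.

Lemma family_mxP n k (f : nat -> 'rV[R]_n) :
  orthonormal_family k f -> family_mx k f *m (family_mx k f)^T = 1%:M.
Proof.
move=> h; apply/matrixP => i j; rewrite !mxE.
have /= <- := h i j (ltn_ord i) (ltn_ord j).
by rewrite dotvE; apply: eq_bigr => l _; rewrite !mxE.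
Qed.

Lemma orthonormal_le n k (f : nat -> 'rV[R]_n) :
  orthonormal_family k f -> (k <= n)%N.
Proof. by move=> /family_mxP /mulmx1_min. Qed.

(** The kernel of the n by k matrix with columns f i has rank at least n - k > 0; any non-zero row
    of it can be normalised. *)
Lemma orthonormal_extend n k (f : nat -> 'rV[R]_n) : (k < n)%N ->
  exists v, dotv v v = 1 /\ forall i, (i < k)%N -> dotv v (f i) = 0.
Proof.
move=> kn; set A := (family_mx k f)^T.
have r0 : kermx A != 0.
  by rewrite -mxrank_eq0 mxrank_ker -lt0n subn_gt0 (leq_ltn_trans (rank_leq_col _)).
have [c [c0 c1 _]] : exists c : R, [/\ 0 < c,
    dotv (c^-1 *: nz_row (kermx A)) (c^-1 *: nz_row (kermx A)) = 1 &
    nz_row (kermx A) = c *: (c^-1 *: nz_row (kermx A))].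
  by apply: normalizeP; rewrite nz_row_eq0.
exists (c^-1 *: nz_row (kermx A)); split=> // i ik.
have /sub_kermxP /rowP /(_ (Ordinal ik)) := nz_row_sub (kermx A).
rewrite !mxE => h; rewrite dotvZl dotvE (_ : \sum_i0 _ = 0) ?mulr0//.
by rewrite -[RHS]h; apply: eq_bigr => l _; rewrite !mxE.
Qed.

Lemma orthonormal_complete n k (f : nat -> 'rV[R]_n) :
  orthonormal_family k f ->
  exists g, orthonormal_family n g /\ forall i, (i < k)%N -> g i = f i.
Proof.
move=> hf; have := orthonormal_le hf.
have [d] := ubnP (n - k)%N; elim: d k f hf => // d IH k f hf dk.
rewrite leq_eqVlt => /orP[/eqP kn|kn].
  by exists f; split=> // i j; rewrite -{1 2}kn => *; exact: hf.
have [v [v1 vf]] := orthonormal_extend f kn.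
have [||//|g [gon gf]] := IH k.+1 (fun i => if (i < k)%N then f i else v).
- move=> i j; rewrite !ltnS.
  case: ltnP => ik hi; case: ltnP => jk hj.
  + exact: hf.
  + by rewrite dotvC vf// (_ : i == j = false)//; apply/eqP; lia.
  + by rewrite vf// (_ : i == j = false)//; apply/eqP; lia.
  + by rewrite v1 (_ : i == j)//; apply/eqP; lia.
- by rewrite ltnS in dk; apply: leq_trans dk; lia.
exists g; split => // i ik; rewrite gf ?ik//; lia.
Qed.

Lemma orthonormal_expand n (f : nat -> 'rV[R]_n) v : orthonormal_family n f ->
  v = \sum_(i < n) dotv v (f i) *: f i.
Proof.
move=> /family_mxP /mulmx1C h; rewrite -{1}[v]mulmx1 -h mulmxA.
rewrite mulmx_sum_row; apply: eq_bigr => i _; rewrite rowK; congr (_ *: _).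
by rewrite mxE dotvE; apply: eq_bigr => l _; rewrite !mxE.
Qed.

Lemma continuous_dotv_mul n k (A : 'M[R]_(n, k)) :
  continuous (fun v : 'rV[R]_n => dotv (v *m A) (v *m A)).
Proof.
have csum (I : Type) (r : seq I) (F : I -> 'rV[R]_n -> R) :
    (forall i, continuous (F i)) -> continuous (fun v => \sum_(i <- r) F i v).
  move=> cF v; elim: r => [|i r IH].
    rewrite (_ : (fun _ => _) = cst 0); first exact: cst_continuous.
    by apply/funext => u; rewrite big_nil.
  rewrite (_ : (fun _ => _) = F i \+ (fun u => \sum_(j <- r) F j u)).
    exact: cvgD (cF i v) IH.
  by apply/funext => u; rewrite big_cons.
rewrite (_ : (fun _ => _) = fun v : 'rV[R]_n => \sum_i
    (\sum_j v 0 j * A j i) * (\sum_j v 0 j * A j i)); last first.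
  by apply/funext => v; rewrite dotvE; apply: eq_bigr => i _; rewrite mxE.
apply: (csum _ _ _) => i v.
have c1 : continuous (fun v : 'rV[R]_n => \sum_j v 0 j * A j i).
  apply: (csum _ _ _) => j u.
  exact: (cvgM (@coord_continuous _ _ _ 0 j u) (cvg_cst (A j i))).
exact: cvgM (c1 v) (c1 v).
Qed.

Lemma unit_sphere_compact n : compact [set v : 'rV[R]_n | dotv v v = 1]%classic.
Proof.
apply: bounded_closed_compact.
  exists 1; split; first exact: num_real.
  move=> M M1 v /= v1; rewrite (le_trans _ (ltW M1))//.
  rewrite [leLHS]mx_normrE; apply/bigmax_leP; split => // -[i j] _ /=.
  rewrite ord1 -(expr_le1 (ltn0Sn 1))// -normrX ger0_norm ?sqr_ge0//.
  rewrite -v1 dotvE (bigD1 j)//= -expr2 lerDl sumr_ge0// => l _.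
  by rewrite -expr2 sqr_ge0.
rewrite (_ : [set _ | _]%classic =
  ((fun v : 'rV[R]_n => dotv (v *m 1%:M) (v *m 1%:M)) @^-1` [set 1])%classic).
  apply: preimage_closed; last exact: closed_eq.
  by move=> v _; exact: continuous_dotv_mul.
by apply/seteqP; split => v /=; rewrite mulmx1.
Qed.

(** First-order condition at a maximum, without derivatives. The choice s = c / (|a| + 1) turns the
    bound into s^2 (|a| + 1 - a) <= 0, where the factor is positive. *)
Lemma linear_le_sqr (a c : R) : (forall s, s * c <= s ^+ 2 * a) -> c = 0.
Proof.
move=> h; apply/eqP; rewrite -sqrf_eq0; apply/eqP/le_anti; rewrite sqr_ge0 andbT.
pose e := c / (`|a| + 1).
have a1 : 0 < `|a| + 1 by rewrite ltr_wpDl.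
have ec : c = e * (`|a| + 1) by rewrite /e mulfVK// gt_eqF.
have := h e; rewrite {1}ec => he.
have e0 : e ^+ 2 * (`|a| + 1 - a) <= 0 by rewrite mulrBr; lra.
have : e ^+ 2 <= 0.
  rewrite -(pmulr_lle0 _ (_ : 0 < `|a| + 1 - a))// 1?mulrC//.
  by have := ler_norm a; lra.
by move=> e2; rewrite ec exprMn; apply: mulr_le0_ge0 => //; exact: sqr_ge0.
Qed.

(* The maximum of |x W|^2 on the unit sphere is attained at an eigenvector of
   W W^T = - W^2. *)
Lemma skew_eigenvector n (W : 'M[R]_n) : W^T = - W -> W != 0 ->
  exists x y mu, [/\ 0 < mu, dotv x x = 1, dotv y y = 1, x *m W = mu *: y &
    y *m W = - mu *: x].
Proof.
move=> hW W0.
have [i Wi0] : exists i, row i W != 0.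
  apply: contrapT => /forallNP h; move/eqP: W0; apply; apply/row_matrixP => i.
  by rewrite row0; apply/eqP/negPn/negP; exact: h.
have A0 : ([set v : 'rV[R]_n | dotv v v = 1] !=set0)%classic.
  by exists 'e_i; rewrite /= dotv_delta mxE !eqxx.
have [|c] := EVT_max_rV A0 (@unit_sphere_compact n)
    (f := fun v => dotv (v *m W) (v *m W)).
  exact/continuous_subspaceT/continuous_dotv_mul.
rewrite inE /= => c1 cmax; set M := dotv (c *m W) (c *m W) in cmax.
have max v : dotv (v *m W) (v *m W) <= M * dotv v v.
  have [->|/normalizeP[a [a0 a1 ->]]] := eqVneq v 0.
    by rewrite mul0mx dotv0l mulr0.
  rewrite -scalemxAl !(dotvZl a) !(dotvZr a) a1 mulr1.
  rewrite (_ : M * _ = a * (a * M)); last by ring.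
  by rewrite !ler_pM2l//; apply: cmax; rewrite inE.
have M0 : 0 < M.
  have := max 'e_i; rewrite dotv_delta mxE !eqxx mulr1; apply: lt_le_trans.
  by rewrite dotv_gt0 -rowE.
(* Comparing the value at c + s y with the maximum leaves a term linear in s bounded by one
   quadratic in s. *)
have orth y : dotv y c = 0 -> dotv (c *m W) (y *m W) = 0.
  move=> yc; suff : 2 * dotv (c *m W) (y *m W) = 0 by lra.
  apply: (@linear_le_sqr (M * dotv y y - dotv (y *m W) (y *m W))) => s.
  have := max (c + s *: y); rewrite mulmxDl -scalemxAl !dotv_lin c1 yc.
  by rewrite (dotvC c y) yc (dotvC (y *m W) (c *m W)) -/M; nra.
have cWW : c *m W *m W = - M *: c.
  apply: eq_dotv => u; rewrite skew_dotv// dotvZl mulNr; congr (- _).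
  have := orth (u - dotv u c *: c); rewrite mulmxBl -scalemxAl !dotv_lin c1 -/M.
  by rewrite mulr1 subrr => /(_ erefl)/eqP; rewrite subr_eq0 mulrC (dotvC u) => /eqP.
have m0 : 0 < Num.sqrt M by rewrite sqrtr_gt0.
have MM : M = Num.sqrt M * Num.sqrt M by rewrite -expr2 sqr_sqrtr// ltW.
exists c, ((Num.sqrt M)^-1 *: (c *m W)), (Num.sqrt M); split => //.
- rewrite !dotv_lin -/M; rewrite [X in _ * (_ * X)]MM; field; exact: lt0r_neq0.
- by rewrite scalerA divff ?scale1r ?lt0r_neq0.
- rewrite -scalemxAl cWW scalerA {2}MM; congr (_ *: _).
  by field; exact: lt0r_neq0.
Qed.

(** The kernel grows strictly, with x as witness. This makes the rank a measure for splitting off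
    one plane of rotation at a time. *)
Lemma skew_rank_drop n (W W' : 'M[R]_n) (x : 'rV[R]_n) : x *m W' = 0 -> x *m W != 0 ->
  (forall v : 'rV[R]_n, v *m W = 0 -> v *m W' = 0) -> (\rank W' < \rank W)%N.
Proof.
move=> xW' xW h.
have : (kermx W < kermx W')%MS.
  rewrite ltmxE; apply/andP; split.
    by apply/row_subP => i; apply/sub_kermxP/h/sub_kermxP/row_sub.
  apply/negP => hx; move/eqP: xW; apply; apply/sub_kermxP.
  by apply: submx_trans hx; apply/sub_kermxP.
move=> /rank_ltmx; rewrite !mxrank_ker => ?.
by have := rank_leq_row W; have := rank_leq_row W'; lia.
Qed.

Lemma skew_normal_form_aux n (W : 'M[R]_n) : W^T = - W ->
  exists r (f : nat -> 'rV[R]_n) (mu : nat -> R),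
  [/\ orthonormal_family r.*2 f,
      forall i, (i < r)%N -> 0 < mu i,
      forall i, (i < r)%N -> f i.*2 *m W = mu i *: f i.*2.+1,
      forall i, (i < r)%N -> f i.*2.+1 *m W = - mu i *: f i.*2 &
      forall v, (forall i, (i < r.*2)%N -> dotv v (f i) = 0) -> v *m W = 0].
Proof.
have [d] := ubnP (\rank W); elim: d W => // d IH W rd hW.
have [->|W0] := eqVneq W 0.
  by exists 0%N, (fun=> 0), (fun=> 0); split => // v _; rewrite mulmx0.
have [x [y [mu [mu0 x1 y1 xW yW]]]] := skew_eigenvector hW W0.
have xy : dotv x y = 0.
  have := skew_dotvv x hW; rewrite xW dotvZl => /eqP.
  by rewrite mulf_eq0 gt_eqF//= dotvC => /eqP.
(* Removes the rotation in the plane of x and y: [W'] is still skew, kills x and y, and agrees with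
   W on their orthogonal complement. *)
pose W' := W - mu *: (x^T *m y - y^T *m x).
have mulE v : v *m W' = v *m W - mu *: (dotv v x *: y - dotv v y *: x).
  by rewrite mulmxBr -scalemxAr mulmxBr !mulmx_outer.
have hW' : W'^T = - W'.
  rewrite /W' linearB /= linearZ /= linearB /= !trmx_mul !trmxK hW opprB.
  by rewrite -scalerN opprB addrC.
have xW' : x *m W' = 0.
  by rewrite mulE xW x1 xy scale0r subr0 scale1r subrr.
have yW' : y *m W' = 0.
  by rewrite mulE yW y1 dotvC xy scale0r sub0r scale1r scalerN opprK scaleNr addNr.
have [||r [f [nu [fon nu0 f1 f2 fk]]]] := IH W'; [|by []|].
  rewrite ltnS in rd; apply: leq_trans rd; apply: (skew_rank_drop xW').
    by rewrite xW scaler_eq0 negb_or gt_eqF//= -dotv_gt0 y1.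
  move=> v vW; rewrite mulE vW.
  have vx : dotv v x = 0.
    have : mu * dotv v x = 0.
      by rewrite -dotvZr -[mu *: x]opprK -scaleNr -yW dotvNr -skew_dotv// vW dotv0l.
    by move/eqP; rewrite mulf_eq0 gt_eqF//= => /eqP.
  have vy : dotv v y = 0.
    have : mu * dotv v y = 0.
      by rewrite -dotvZr -xW -[LHS]opprK -skew_dotv// vW dotv0l oppr0.
    by move/eqP; rewrite mulf_eq0 gt_eqF//= => /eqP.
  by rewrite vx vy !scale0r subrr scaler0 subrr.
(* Each f i is, up to a non-zero factor, the image under [W'] of its partner, and the image of a
   skew matrix is orthogonal to its kernel. *)
have perp z i : z *m W' = 0 -> (i < r.*2)%N -> dotv (f i) z = 0.
  move=> zW' ir; have := odd_double_half i.
  have ir' : (i./2 < r)%N by lia.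
  have z0 v : dotv (v *m W') z = 0 by rewrite skew_dotv// zW' dotv0r oppr0.
  case: (odd i) => /= <-; rewrite ?add1n ?add0n.
    have := z0 (f i./2.*2); rewrite f1// dotvZl => /eqP.
    by rewrite mulf_eq0 gt_eqF ?nu0//= => /eqP.
  have := z0 (f i./2.*2.+1); rewrite f2// dotvZl mulNr => /eqP.
  by rewrite oppr_eq0 mulf_eq0 gt_eqF ?nu0//= => /eqP.
pose g i := if i is i'.+2 then f i' else if i is 1%N then y else x.
have gW i : (i < r.*2)%N -> f i *m W = f i *m W'.
  by move=> ir; rewrite mulE !perp// !scale0r subrr scaler0 subr0.
exists r.+1, g, (fun i => if i is i'.+1 then nu i' else mu); split.
- move=> [|[|i]] [|[|j]] //=; rewrite ?doubleS ?ltnS => // ir jr.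
  + by rewrite dotvC perp.
  + by rewrite dotvC xy.
  + by rewrite dotvC perp.
  + by rewrite perp.
  + by rewrite perp.
  + by rewrite fon// !eqSS.
- by case.
- by case=> [|i] // ir; rewrite doubleS /= gW ?f1//; lia.
- by case=> [|i] // ir; rewrite doubleS /= gW ?f2//; lia.
- move=> v hv; have := fk v; rewrite mulE.
  have /= -> := hv 0%N isT; have /= -> := hv 1%N isT.
  rewrite !scale0r subrr scaler0 subr0; apply => i ir.
  by have /= := hv i.+2; apply; rewrite doubleS !ltnS.
Qed.

Lemma skew_normal_form n (W : 'M[R]_n) : W^T = - W ->
  exists r (f : nat -> 'rV[R]_n) (mu : nat -> R),
  [/\ orthonormal_family n f,
      (r.*2 <= n)%N,
      forall i, (i < r)%N -> [/\ 0 < mu i, f i.*2 *m W = mu i *: f i.*2.+1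
        & f i.*2.+1 *m W = - mu i *: f i.*2] &
      forall i, (r.*2 <= i < n)%N -> f i *m W = 0].
Proof.
move=> /skew_normal_form_aux[r [f [mu [fon mu0 f1 f2 fk]]]].
have rn := orthonormal_le fon.
have [g [gon gf]] := orthonormal_complete fon.
exists r, g, mu; split => // i ir.
  by rewrite !gf; [rewrite f1 ?f2 ?mu0|lia..].
have /andP[ri im] := ir; apply: fk => j jr; have <- := gf j jr.
rewrite gon//; last by apply: leq_trans jr rn.
by case: eqP => // ij; move: jr; rewrite -ij ltnNge ri.
Qed.
End Dot.

(** * Directional derivatives *)

Section Calculus.
Context {R : realType}.

Section Rules.
Context {V W : normedModType R}.
Implicit Types (x v : V).

(** The rules are restated with pointwise function bodies, so that they unify syntactically with
    explicit formulas. *)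
Lemma is_derive_cstf x v (a : W) : is_derive x v (fun=> a) 0.
Proof. exact: is_derive_cst. Qed.

Lemma is_derive_addf x v (f g : V -> W) df dg : is_derive x v f df ->
  is_derive x v g dg -> is_derive x v (fun t => f t + g t) (df + dg).
Proof. exact: is_deriveD. Qed.

Lemma is_derive_oppf x v (f : V -> W) df : is_derive x v f df ->
  is_derive x v (fun t => - f t) (- df).
Proof. exact: is_deriveN. Qed.

Lemma is_derive_mulf x v (f g : V -> R) df dg : is_derive x v f df ->
  is_derive x v g dg ->
  is_derive x v (fun t => f t * g t) (df * g x + f x * dg).
Proof.
move=> hf hg; apply: is_derive_eq (is_deriveM hf hg) _.
by rewrite addrC mulrC [X in _ + X]mulrC mulrC [_ *: _]mulrC.
Qed.

Lemma is_derive_sumf x v (I : Type) (r : seq I) (F : I -> V -> W) dF :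
  (forall i, is_derive x v (F i) (dF i)) ->
  is_derive x v (fun t => \sum_(i <- r) F i t) (\sum_(i <- r) dF i).
Proof.
move=> h; elim: r => [|i r IH].
  rewrite big_nil (_ : (fun _ => _) = fun=> 0); first exact: is_derive_cstf.
  by apply/funext => t; rewrite big_nil.
rewrite big_cons (_ : (fun _ => _) = fun t => F i t + \sum_(j <- r) F j t).
  exact: is_derive_addf.
by apply/funext => t; rewrite big_cons.
Qed.

(** A directional derivative is a derivative along a line; this imports the one-variable chain
    rule. *)
Lemma is_derive_lineE x v (f : V -> W) df :
  is_derive x v f df <-> is_derive (0 : R) (1 : R) (fun h => f (h *: v + x)) df.
Proof.
have e : (fun h : R => h^-1 *: ((f \o shift x) (h *: v) - f x)) =
    (fun h : R => h^-1 *: (((fun h => f (h *: v + x)) \o shift (0 : R)) (h *: (1 : R))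
       - (fun h => f (h *: v + x)) 0)).
  by apply/funext => h /=; rewrite scale0r add0r addr0 [h *: 1]mulr1.
by split => -[d1 d2]; split; move: d1 d2; rewrite /derivable /derive e.
Qed.

Lemma is_derive_val x v (f : V -> W) df : is_derive x v f df -> 'D_v f x = df.
Proof. by case. Qed.

Lemma is_derive_ext x v (f g : V -> W) df :
  f =1 g -> is_derive x v f df -> is_derive x v g df.
Proof. by move=> /funext ->. Qed.

Lemma is_derive_unique x v (f : V -> W) df dg :
  is_derive x v f df -> is_derive x v f dg -> df = dg.
Proof. by move=> [_ <-] [_ <-]. Qed.
End Rules.

Section RealRules.
Context {V : normedModType R}.
Implicit Types (x v : V).

Lemma is_derive_compf x v (g : R -> R) (f : V -> R) df dg :
  is_derive (f x) 1 g dg -> is_derive x v f df ->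
  is_derive x v (fun t => g (f t)) (dg * df).
Proof.
move=> hg /is_derive_lineE hf; apply/is_derive_lineE.
by apply: is_derive1_comp => //; rewrite scale0r add0r.
Qed.

Lemma is_derive_invf x v (f : V -> R) df : f x != 0 -> is_derive x v f df ->
  is_derive x v (fun t => (f t)^-1) (- (f x) ^- 2 * df).
Proof.
move=> f0 hf; apply: is_derive_compf hf.
apply: is_derive_eq; first exact: (@is_deriveV _ id _ 1 _ f0 (is_derive_id _ _)).
by rewrite [_ *: _]mulr1.
Qed.

Lemma is_derive_mxP m n x v (f : V -> 'M[R]_(m, n)) df :
  is_derive x v f df <->
  forall i j, is_derive x v (fun t => f t i j) (df i j).
Proof.
split=> [[d1 d2] i j|h].
  split; first by move/derivable_mxP: d1; exact.
  by have := derive_mx d1; rewrite d2 => ->; rewrite mxE.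
have d : derivable f x v by apply/derivable_mxP => i j; case: (h i j).
split => //; rewrite derive_mx//; apply/matrixP => i j; rewrite mxE.
by case: (h i j).
Qed.

Lemma is_derive_mulmxr m n p x v (f : V -> 'M[R]_(m, n)) df (A : 'M[R]_(n, p)) :
  is_derive x v f df -> is_derive x v (fun t => f t *m A) (df *m A).
Proof.
move=> /is_derive_mxP h; apply/is_derive_mxP => i j; rewrite mxE.
apply: (is_derive_ext (f := fun t => \sum_k f t i k * A k j)).
  by move=> t; rewrite mxE.
apply: is_derive_sumf => k.
apply: (is_derive_eq (is_derive_mulf (h i k) (is_derive_cstf _ _ _))).
by rewrite mulr0 addr0.
Qed.

Lemma is_derive_dotv n x v (f g : V -> 'rV[R]_n) df dg :
  is_derive x v f df -> is_derive x v g dg ->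
  is_derive x v (fun t => dotv (f t) (g t)) (dotv df (g x) + dotv (f x) dg).
Proof.
move=> /is_derive_mxP hf /is_derive_mxP hg.
apply: (is_derive_ext (f := fun t => \sum_k f t 0 k * g t 0 k)).
  by move=> t; rewrite dotvE.
rewrite !dotvE -big_split /=; apply: is_derive_sumf => k.
exact: is_derive_mulf.
Qed.

Lemma is_derive_scalef m n x v (a : V -> R) (f : V -> 'M[R]_(m, n)) da df :
  is_derive x v a da -> is_derive x v f df ->
  is_derive x v (fun t => a t *: f t) (da *: f x + a x *: df).
Proof.
move=> ha /is_derive_mxP hf; apply/is_derive_mxP => i j; rewrite !mxE.
apply: (is_derive_ext (f := fun t => a t * f t i j)); last exact: is_derive_mulf.
by move=> t; rewrite mxE.
Qed.

Lemma is_derive_entry m n x v (f : V -> 'M[R]_(m, n)) df i j :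
  is_derive x v f df -> is_derive x v (fun t => f t i j) (df i j).
Proof. by move=> /is_derive_mxP; exact. Qed.

Lemma is_derive_idf x v : is_derive x v (fun t => t) v.
Proof. exact: is_derive_id. Qed.

End RealRules.
End Calculus.

(* is_derive is a type class: without notypeclasses, unification would fill the
   premises with the instances of MathComp-Analysis. *)
Ltac derive_tac := repeat first
  [ eassumption
  | notypeclasses refine (is_derive_cstf _ _ _)
  | notypeclasses refine (is_derive_idf _ _)
  | notypeclasses refine (is_derive_addf _ _)
  | notypeclasses refine (is_derive_oppf _)
  | notypeclasses refine (is_derive_mulf _ _)
  | notypeclasses refine (is_derive_scalef _ _)
  | notypeclasses refine (is_derive_dotv _ _)
  | notypeclasses refine (is_derive_mulmxr _ _)
  | notypeclasses refine (is_derive_invf _ _) ].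

Ltac derive_eq := notypeclasses refine (is_derive_eq _ _); [derive_tac|]; cbv beta.

(** * Stereographic charts *)

Section Chart.
Context {R : realType} (n : nat).
Implicit Types (x : 'rV[R]_n.+1) (E : 'M[R]_(n, n.+1)) (u v w : 'rV[R]_n).

Lemma dotv_add1_gt0 k (u : 'rV[R]_k) : 0 < 1 + dotv u u.
Proof. by rewrite ltr_pwDl// dotv_ge0. Qed.

Lemma dotv_add1_neq0 k (u : 'rV[R]_k) : 1 + dotv u u != 0.
Proof. by rewrite gt_eqF// dotv_add1_gt0. Qed.

Definition dchart x E u v : 'rV[R]_n.+1 :=
  (2 / (1 + dotv u u) ^+ 2) *:
   ((1 + dotv u u) *: (v *m E) - (2 * dotv u v) *: (x + u *m E)).

Lemma is_derive_chart x E u v : is_derive u v (chart x E) (dchart x E u v).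
Proof.
have n0 := dotv_add1_neq0 u.
rewrite /chart; derive_eq.
rewrite /dchart (dotvC v u) add0r !scaler0 !addr0 scale0r add0r.
apply/rowP => i; rewrite !mxE -/(dotv u u).
move: n0; set r := dotv u u; set a := dotv u v.
set s := \sum_j u _ _ * _; set t := \sum_j v _ _ * _ => n0.
by field.
Qed.

Lemma frame_dotE x E v w : frame x E -> dotv (v *m E) (w *m E) = dotv v w.
Proof. by move=> [_ h _]; rewrite dotv_mul -mulmxA h mulmx1. Qed.

Lemma frame_dot0 x E v : frame x E -> dotv (v *m E) x = 0.
Proof. by move=> [_ _ h]; rewrite /dotv -mulmxA h mulmx0 mxE. Qed.

(** The square matrix with rows x and E is orthogonal, so its one-sided inverse is two-sided; read
    the other way round, E^T E is the orthogonal projection onto the tangent space. *)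
Lemma frame_tr x E : frame x E -> E^T *m E = 1%:M - x^T *m x.
Proof.
move=> [hx h1 h2].
have : col_mx x E *m (col_mx x E)^T = 1%:M.
  rewrite tr_col_mx mul_col_row h1 h2 (_ : x *m E^T = 0).
    rewrite (_ : x *m x^T = 1%:M); first by rewrite -scalar_mx_block.
    by apply/matrixP => i j; rewrite !ord1 -[LHS]/(dotv x x) hx !mxE.
  by rewrite -[LHS]trmxK trmx_mul trmxK h2 trmx0.
move=> /mulmx1C; rewrite tr_col_mx mul_row_col => <-.
by rewrite addrC addKr.
Qed.

Lemma chart_sphere x E u : frame x E -> sphere (chart x E u).
Proof.
move=> fr; rewrite /sphere /chart !dotv_lin !(frame_dotE _ _ fr).
rewrite (dotvC x) !(frame_dot0 _ fr); have [-> _ _] := fr.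
by field; exact: dotv_add1_neq0.
Qed.

Lemma chart0 x E : chart x E 0 = x.
Proof.
rewrite /chart dotv0l mul0mx scaler0 subr0 !addr0 scale1r.
by rewrite invr1 scale1r.
Qed.

(** Stereographic projection is conformal: since |x + u E|^2 = 1 + |u|^2, the product of the two
    correction terms cancels the cross terms. *)
Lemma dotv_dchart x E u v w : frame x E ->
  dotv (dchart x E u v) (dchart x E u w) = 4 / (1 + dotv u u) ^+ 2 * dotv v w.
Proof.
move=> fr; rewrite /dchart !dotv_lin !(frame_dotE _ _ fr).
rewrite !(dotvC x) !(frame_dot0 _ fr); have [-> _ _] := fr.
rewrite (dotvC v u).
by field; exact: dotv_add1_neq0.
Qed.

Lemma row_chart_basis x E u i : row i (chart_basis x E u) = dchart x E u ('e_i).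
Proof.
apply/rowP => c; rewrite [LHS]mxE [LHS]mxE; apply: is_derive_val.
exact: (is_derive_entry 0 c (is_derive_chart x E u 'e_i)).
Qed.

Lemma chart_basisE x E u (w : 'rV[R]_n.+1) : w *m (chart_basis x E u)^T =
  \row_i dotv w (dchart x E u ('e_i)).
Proof.
apply/rowP => i; rewrite !mxE -row_chart_basis dotvE.
by apply: eq_bigr => j _; rewrite !mxE.
Qed.

Definition conf (u : 'rV[R]_n) : R := 4 / (1 + dotv u u) ^+ 2.

Lemma conf_gt0 u : 0 < conf u.
Proof. by rewrite divr_gt0// exprn_gt0// dotv_add1_gt0. Qed.

Lemma sphere_metricE x E u : frame x E -> sphere_metric x E u = (conf u)%:M.
Proof.
move=> fr; apply/matrixP => i j; rewrite !mxE.
transitivity (dotv (dchart x E u 'e_i) (dchart x E u 'e_j)).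
  by rewrite -!row_chart_basis dotvE; apply: eq_bigr => k _; rewrite !mxE.
rewrite dotv_dchart// dotv_delta mxE eqxx /= (eq_sym j).
by case: (i == j); rewrite ?mulr1 ?mulr0.
Qed.

Lemma invmx_metric x E u : frame x E ->
  invmx (sphere_metric x E u) = (conf u)^-1%:M.
Proof. by move=> fr; rewrite sphere_metricE// invmx_scalar. Qed.

Lemma is_derive_conf u v :
  is_derive u v conf (- 16 * dotv u v / (1 + dotv u u) ^+ 3).
Proof.
have n0 := dotv_add1_neq0 u.
apply: (is_derive_ext (f := fun u => 4 / ((1 + dotv u u) * (1 + dotv u u)))).
  by move=> w; rewrite /conf expr2.
derive_eq; first by rewrite mulf_neq0.
by rewrite (dotvC v u); field.
Qed.

(** Formula for a conformally flat metric: with phi half the logarithm of [conf], the j-th partial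
    derivative of phi is -2 u_j / (1 + |u|^2). *)
Lemma christoffel_sphere x E u k i j : frame x E ->
  christoffel (sphere_metric x E) u k i j =
  - 2 / (1 + dotv u u) *
    (u 0 j *+ (k == i) + u 0 i *+ (k == j) - u 0 k *+ (i == j)).
Proof.
move=> fr; have n0 := dotv_add1_neq0 u.
have dg a b c : 'D_('e_a) (fun v => sphere_metric x E v b c) u =
    - 16 * u 0 a / (1 + dotv u u) ^+ 3 *+ (b == c).
  apply: is_derive_val.
  apply: (is_derive_ext (f := fun v => conf v * (b == c)%:R)).
    by move=> v; rewrite sphere_metricE// mxE mulr_natr.
  apply: (is_derive_eq
    (is_derive_mulf (is_derive_conf u 'e_a) (is_derive_cstf _ _ _))).
  by rewrite mulr0 addr0 dotv_delta mulr_natr.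
rewrite /christoffel invmx_metric// (bigD1 k)//= big1 ?addr0; last first.
  by move=> l lk; rewrite mxE eq_sym (negbTE lk) mul0r.
rewrite !dg mxE eqxx mulr1n /conf (eq_sym j k) (eq_sym i k).
by case: (k == j); case: (k == i); case: (i == j); rewrite ?mulr1n ?mulr0n; field.
Qed.

Lemma coord_fieldE xi x E u i : frame x E ->
  coord_field xi x E u 0 i =
    (conf u)^-1 * dotv (xi (chart x E u)) (dchart x E u 'e_i).
Proof.
by move=> fr; rewrite /coord_field invmx_metric// chart_basisE mul_mx_scalar !mxE.
Qed.

(** In stereographic coordinates an infinitesimal rotation is a vector field quadratic in u, so the
    derivatives of the section are explicit. *)
Lemma coord_field_linear xi W x E u : frame x E -> W^T = - W ->
  (forall y, sphere y -> xi y = y *m W) ->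
  coord_field xi x E u = 2^-1 *: ((1 - dotv u u) *: (x *m W *m E^T)
    + 2 *: (u *m (E *m W *m E^T)) + (2 * dotv u (x *m W *m E^T)) *: u).
Proof.
move=> fr hW hxi; have [hx h1 h2] := fr; apply/rowP => i.
rewrite coord_fieldE// hxi; last exact: chart_sphere.
rewrite /dchart /chart -scalemxAl mulmxDl -!scalemxAl.
set v : 'rV[R]_n := 'e_i.
have bE w : dotv (x *m W *m E^T) w = dotv (x *m W) (w *m E).
  by rewrite dotv_mul trmxK.
have oE w : dotv (u *m (E *m W *m E^T)) w = dotv (u *m E *m W) (w *m E).
  by rewrite !mulmxA dotv_mul trmxK.
rewrite -[RHS]dotv_delta -/v !dotv_lin bE oE (dotvC u (x *m W *m E^T)) bE.
rewrite (skew_dotvv x hW) (skew_dotvv (u *m E) hW) (skew_dotv (u *m E) x hW).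
rewrite (dotvC (u *m E) (x *m W)).
by rewrite /conf; field; exact: dotv_add1_neq0.
Qed.
End Chart.

(** * Killing fields are linear *)

Section Killing.
Context {R : realType} (n : nat).
Implicit Types (x e y : 'rV[R]_n.+1) (E : 'M[R]_(n, n.+1)) (u : 'rV[R]_n).
Implicit Types (xi : 'rV[R]_n.+1 -> 'rV[R]_n.+1).

Lemma exists_frame x : sphere x -> exists E, frame x E.
Proof.
move=> hx.
have [|g [gon gf]] := @orthonormal_complete R n.+1 1 (fun=> x).
  by move=> [|i] [|j].
exists (\matrix_i g i.+1); split => //.
  apply/matrixP => i j; rewrite !mxE.
  have /= := gon i.+1 j.+1 (ltn_ord i) (ltn_ord j); rewrite eqSS => <-.
  by rewrite dotvE; apply: eq_bigr => l _; rewrite !mxE.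
apply/matrixP => i j; rewrite ord1 !mxE.
transitivity (dotv (g i.+1) (g 0%N)); last by rewrite gon//= ltnS.
by rewrite dotvE (gf 0%N isT); apply: eq_bigr => l _; rewrite !mxE.
Qed.

(** Aligns a coordinate axis of the chart with a prescribed great circle. The completed basis has v
    in position 0; a row exchange moves it to i. *)
Lemma frame_rotate x E (v : 'rV[R]_n) (i : 'I_n) : frame x E -> dotv v v = 1 ->
  exists2 E', frame x E' & row i E' = v *m E.
Proof.
move=> [hx h1 h2] v1.
have [|g [gon gf]] := @orthonormal_complete R n 1 (fun=> v).
  by move=> [|j] [|k].
have n0 : (0 < n)%N by apply: leq_trans (ltn_ord i).
pose Q := xrow i (Ordinal n0) (family_mx n g).
have Q1 : Q *m Q^T = 1%:M.
  apply/matrixP => j k; rewrite !mxE.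
  rewrite -(inj_eq (@perm.perm_inj _ (perm.tperm i (Ordinal n0)))).
  rewrite -[RHS]gon ?ltn_ord// dotvE.
  by apply: eq_bigr => l _; rewrite !mxE.
exists (Q *m E); first split => //.
- by rewrite trmx_mul mulmxA -(mulmxA Q) h1 mulmx1.
- by rewrite -mulmxA h2 mulmx0.
rewrite row_mul; congr (_ *m _); apply/rowP => j.
by rewrite !mxE perm.tpermL /= gf.
Qed.

Lemma tangent_frame x E e : frame x E -> dotv e x = 0 -> (e *m E^T) *m E = e.
Proof.
move=> fr ex; rewrite -mulmxA (frame_tr fr) mulmxBr mulmx1 mulmxA.
rewrite (_ : e *m x^T = 0) ?mul0mx ?subr0//.
by apply/matrixP => i j; rewrite !ord1 [RHS]mxE.
Qed.

Lemma is_derive_dchart x E u w v : exists d,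
  is_derive u v (fun u => dchart x E u w) d.
Proof.
have n0 := dotv_add1_neq0 u.
eexists; apply: (is_derive_ext (f := fun u =>
  (2 * ((1 + dotv u u) * (1 + dotv u u))^-1) *:
   ((1 + dotv u u) *: (w *m E) + - ((2 * dotv u w) *: (x + u *m E))))).
  by move=> z; rewrite /dchart expr2.
by derive_tac; rewrite mulf_neq0.
Qed.

Lemma derivable_coord_field xi x E u i : vector_field xi -> frame x E ->
  derivable (fun v => coord_field xi x E v 0 i) u 'e_i.
Proof.
move=> [_ hC] fr; have n0 := dotv_add1_neq0 u.
have [d dd] := is_derive_dchart x E u ('e_i) ('e_i).
have dxi : is_derive u 'e_i (fun v => xi (chart x E v))
    (\row_c 'D_('e_i) (fun v => xi (chart x E v) 0 c) u).
  apply/is_derive_mxP => a c; rewrite ord1 mxE; apply/derivableP.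
  by have [_ /(_ i) [+ _]] := hC x E fr c 1%N; apply.
have e : (fun v => coord_field xi x E v 0 i) = (fun v =>
    (4^-1 * ((1 + dotv v v) * (1 + dotv v v))) *
     dotv (xi (chart x E v)) (dchart x E v 'e_i)).
  apply/funext => v; rewrite coord_fieldE// /conf; congr (_ * _).
  by field; exact: dotv_add1_neq0.
rewrite e; apply: ex_derive; apply: is_derive_mulf; first by derive_tac.
exact: is_derive_dotv dxi dd.
Qed.

(* Along the great circle s |-> chart x E (s e_i) the (i, i) Killing equation
   says that the i-th component of xi solves w' = 2 s / (1 + s^2) w. *)
Lemma killing_great_circle xi x E i (s : R) : killing xi -> frame x E ->
  coord_field xi x E (s *: 'e_i) 0 i =
    (1 + s ^+ 2) * coord_field xi x E 0 0 i.
Proof.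
move=> [hv hk] fr.
have := hk x E fr ^~ i ^~ i.
have := fun u => derivable_coord_field (u := u) (i := i) hv fr.
have -> : sphere_metric x E = fun u => (conf u)%:M.
  by apply/funext => u; exact: sphere_metricE.
move: (coord_field xi x E) => S dS kS.
pose w (s : R) : R := S (s *: 'e_i) 0 i.
have se (t : R) : dotv (t *: 'e_i) (t *: 'e_i : 'rV[R]_n) = t ^+ 2.
  by rewrite dotvZl dotvZr dotv_delta mxE !eqxx mulr1 expr2.
have t0 (t : R) : 1 + t ^+ 2 != 0 by rewrite gt_eqF// ltr_pwDl// sqr_ge0.
have scal (a : R) j k : (a%:M : 'M[R]_n) j k = a *+ (j == k) by rewrite mxE.
have dconf (t : R) j : 'D_('e_j) (fun v => ((conf v)%:M : 'M[R]_n) i i) (t *: 'e_i) =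
    - 16 * t / (1 + t ^+ 2) ^+ 3 *+ (i == j).
  apply: is_derive_val; apply: (is_derive_ext (f := @conf R n)).
    by move=> v; rewrite scal eqxx.
  apply: is_derive_eq; first exact: is_derive_conf.
  rewrite dotv_delta 2!mxE eqxx se eq_sym.
  by case: eqP; rewrite ?mulr1 ?mulr0 ?mul0r.
have dw (t : R) : is_derive t (1 : R) w (2 * t / (1 + t ^+ 2) * w t).
  have -> : 2 * t / (1 + t ^+ 2) * w t =
      'D_('e_i) (fun v => S v 0 i) (t *: 'e_i).
    have := kS (t *: 'e_i) => /=.
    (* For k other than i the metric coefficient g_ki is 0, and the k-th derivative of the conformal
       factor, proportional to u_k, vanishes on the i-th axis. *)
    rewrite (bigD1 i)//= big1 ?addr0; last first.
      move=> k ki; rewrite dconf !scal (eq_sym i) (negbTE ki) !mulr0n.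
      by rewrite mulr0 !mul0r !addr0.
    rewrite dconf scal eqxx !mulr1n /conf se -/(w t).
    set D := 'D_('e_i) _ _ => h.
    have : 8 / (1 + t ^+ 2) ^+ 2 * D = 8 / (1 + t ^+ 2) ^+ 2 *
        (2 * t / (1 + t ^+ 2) * w t).
      by apply/eqP; rewrite -subr_eq0 -h; apply/eqP; field.
    move/mulfI => ->//.
    by rewrite mulf_neq0 ?invr_neq0 ?expf_neq0// pnatr_eq0.
  have /is_derive_lineE d := derivableP (dS (t *: 'e_i)).
  apply/is_derive_lineE; apply: is_derive_ext d => h /=.
  by rewrite /w [h *: 1]mulr1 scalerDl.
(* (1 + t^2)^-1 is the integrating factor of the differential equation for [w]. *)
have dq (t : R) : is_derive t (1 : R) (fun t => w t * (1 + t * t)^-1) 0.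
  have tt0 : 1 + t * t != 0 by rewrite -expr2.
  have d1 : is_derive t (1 : R) (fun t : R => (1 + t * t)^-1)
      (- (1 + t * t) ^- 2 * (2 * t)).
    have d2 := is_derive_addf (is_derive_cstf t (1 : R) (1 : R))
      (is_derive_mulf (is_derive_idf t 1) (is_derive_idf t 1)).
    by apply: is_derive_eq (is_derive_invf (f := fun t : R => 1 + t * t) tt0 d2) _; field.
  apply: is_derive_eq (is_derive_mulf (dw t) d1) _.
  by rewrite !expr2; field.
have := is_derive_0_is_cst s 0 dq; rewrite /w scale0r mulr0 addr0 invr1 mulr1.
by move=> <-; rewrite expr2; field; rewrite -expr2.
Qed.

Lemma killing_skew xi x y : killing xi -> sphere x -> sphere y ->
  dotv (xi x) y + dotv (xi y) x = 0.
Proof.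
move=> hk hx hy; have [[htan _] _] := hk.
have x1 : dotv x x = 1 := hx; have y1 : dotv y y = 1 := hy.
set a := dotv x y; have yE : y = a *: x + (y - a *: x) by rewrite addrC subrK.
(* If y is a multiple of x, tangency at both points suffices. Otherwise y = a x + c e, with e a unit
   tangent vector at x. *)
have [y0|] := eqVneq (y - a *: x) 0.
  have ya : y = a *: x by rewrite {1}yE y0 addr0.
  have a0 : a != 0.
    apply/eqP => a0; move: y1; rewrite ya a0 scale0r dotv0l => /eqP.
    by rewrite eq_sym oner_eq0.
  have := htan y hy; rewrite {2}ya dotvZr => /eqP.
  rewrite mulf_eq0 (negbTE a0) /= => /eqP ->.
  by rewrite {1}ya dotvZr htan// mulr0 addr0.
move=> /normalizeP[c [c0 e1 ec]]; set e := c^-1 *: _ in e1 ec.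
have ex : dotv e x = 0.
  by rewrite /e !dotv_lin x1 mulr1 (dotvC y) subrr mulr0.
clearbody e a.
have ac : a ^+ 2 + c ^+ 2 = 1.
  move: y1; rewrite yE ec !dotv_lin x1 e1 (dotvC x e) ex => <-; ring.
have a1 : 1 + a != 0.
  apply/eqP => a1; have : c ^+ 2 = 0.
    have -> : c ^+ 2 = (1 + a) * (1 - a) by lra.
    by rewrite a1 mul0r.
  by move/eqP; rewrite expf_eq0/= gt_eqF.
have [E0 fr0] := exists_frame hx.
have e0E : e *m E0^T *m E0 = e := tangent_frame fr0 ex.
have v1 : dotv (e *m E0^T) (e *m E0^T) = 1.
  by rewrite -(frame_dotE _ _ fr0) e0E.
have [i _] : exists i, (e *m E0^T) 0 i != 0.
  by apply/rV0Pn; rewrite -dotv_gt0 v1.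
have [E fr Ei] := frame_rotate i fr0 v1.
have eE : 'e_i *m E = e by rewrite -rowE Ei e0E.
(* Tangent of the half angle between x and y, the stereographic parameter of y on the great circle;
   1 + a is non-zero because c is. *)
pose s := c / (1 + a).
have s0 : 1 + s ^+ 2 != 0 by rewrite gt_eqF// ltr_pwDl// sqr_ge0.
have se (t : R) : dotv (t *: 'e_i) (t *: 'e_i : 'rV[R]_n) = t ^+ 2.
  by rewrite dotvZl dotvZr dotv_delta mxE !eqxx mulr1 expr2.
have cE : chart x E (s *: 'e_i) = (1 + s ^+ 2)^-1 *: ((1 - s ^+ 2) *: x + (2 * s) *: e).
  by rewrite /chart se -scalemxAl eE scalerA.
have s2 : 1 + s ^+ 2 = 2 / (1 + a).
  rewrite /s expr_div_n (_ : c ^+ 2 = (1 - a) * (1 + a)); last by lra.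
  by field.
have s1 : 1 - s ^+ 2 = 2 * a / (1 + a).
  have -> : 1 - s ^+ 2 = 2 - (1 + s ^+ 2) by ring.
  by rewrite s2; field.
have cy : chart x E (s *: 'e_i) = y.
  rewrite cE s1 s2 yE ec scalerDr !scalerA.
  by congr (_ *: _ + _ *: _); rewrite /s; field.
have := etrans (esym (coord_fieldE xi (s *: 'e_i) i fr))
  (etrans (killing_great_circle i s hk fr)
    (congr1 _ (coord_fieldE xi 0 i fr))).
rewrite cy chart0 /dchart se dotv0l mul0mx -scalemxAl eE.
rewrite /conf se !dotv_lin !dotv_delta !mxE !eqxx.
have := htan y hy; rewrite {2}yE ec.
have -> : dotv (xi x) y = c * dotv (xi x) e.
  by rewrite {1}yE ec !dotv_lin htan// mulr0 add0r.
rewrite !dotv_lin.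
set X := dotv (xi y) x; set Y := dotv (xi y) e; set P := dotv (xi x) e.
rewrite /= => h1 h2.
have h3 : (1 - s ^+ 2) * Y - 2 * s * X = (1 + s ^+ 2) * P.
  apply: (@mulfI _ 2^-1); first by rewrite invr_neq0// pnatr_eq0.
  have <- : (1 + s ^+ 2) * ((4 / (1 + 0) ^+ 2)^-1 *
      (2 / (1 + 0) ^+ 2 * ((1 + 0) * P - 2 * 0 * (dotv (xi x) x + 0)))) =
      2^-1 * ((1 + s ^+ 2) * P) by field.
  rewrite -h2; field; exact: s0.
move: h3; rewrite s1 s2 /s => h3.
(* The conserved quantity: a e - c x is the unit tangent of the great circle at y, as e is at x.
   With tangency of xi at y, a X + c Y = 0, it yields X + c P = 0. *)
have h4 : a * Y - c * X = P.
  have a2 : 2 / (1 + a) != 0 by rewrite mulf_neq0 ?invr_neq0// pnatr_eq0.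
  by apply: (mulfI a2); rewrite -h3; field.
rewrite -h4; have -> : c * (a * Y - c * X) + X = a * (a * X + c * Y)
  + (1 - (a ^+ 2 + c ^+ 2)) * X by ring.
by rewrite h1 ac subrr mul0r mulr0 addr0.
Qed.

(** The skew identity with y = e_j expresses the j-th component of xi x as - <xi e_j, x>, which is
    visibly linear in x; the rows of W are the values at the e_i. *)
Lemma killing_linear xi : killing xi -> exists2 W : 'M[R]_n.+1, W^T = - W &
  forall x, sphere x -> xi x = x *m W.
Proof.
move=> hk; have sph i : sphere ('e_i : 'rV[R]_n.+1).
  by rewrite /sphere dotv_delta mxE !eqxx.
have sk i j : xi 'e_i 0 j = - xi 'e_j 0 i.
  by apply/eqP; rewrite -addr_eq0 -!dotv_delta killing_skew.
exists (\matrix_(i, j) xi 'e_i 0 j).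
  by apply/matrixP => i j; rewrite !mxE sk.
move=> x hx; apply/rowP => j; rewrite mxE.
have := killing_skew hk hx (sph j); rewrite dotv_delta => /eqP.
rewrite addr_eq0 => /eqP ->; rewrite dotvC dotvE -sumrN.
by apply: eq_bigr => i _; rewrite mxE (sk i) mulrN.
Qed.
End Killing.

(** * The tension field of a section *)

Section TensionPairing.
Context {R : realType}.

Lemma scalar_delta n (L : 'rV[R]_n -> R) (w : 'rV[R]_n) : scalar L ->
  \sum_i L ('e_i) * w 0 i = L w.
Proof.
move=> hL; have L0 : L 0 = 0 by have := hL (-1) 0 0; rewrite scaler0 addr0; lra.
have LD u v : L (u + v) = L u + L v by have := hL 1 u v; rewrite scale1r mul1r.
have LZ a v : L (a *: v) = a * L v by have := hL a v 0; rewrite L0 !addr0.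
rewrite [in RHS](row_sum_delta w) (big_morph L LD L0).
by apply: eq_bigr => i _; rewrite LZ mulrC.
Qed.

Definition trilinear n (T : 'rV[R]_n -> 'rV[R]_n -> 'rV[R]_n -> R) :=
  [/\ forall a b, scalar (fun d => T d a b),
      forall d b, scalar (fun a => T d a b) &
      forall d a, scalar (T d a)].

Lemma trilinear_delta2 n T (w l : 'rV[R]_n) : trilinear T ->
  \sum_b \sum_c T 'e_b 'e_c l * w 0 b * w 0 c = T w w l.
Proof.
move=> [h1 h2 h3]; rewrite -(scalar_delta w (h1 w l)); apply: eq_bigr => b _.
rewrite -(scalar_delta w (h2 'e_b l)) mulr_suml; apply: eq_bigr => c _.
by rewrite mulrAC.
Qed.

Lemma trilinear_delta3 n T (w l : 'rV[R]_n) : trilinear T ->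
  \sum_b \sum_c T l 'e_b 'e_c * w 0 b * w 0 c = T l w w.
Proof.
move=> [h1 h2 h3]; rewrite -(scalar_delta w (h2 l w)); apply: eq_bigr => b _.
rewrite -(scalar_delta w (h3 l 'e_b)) mulr_suml; apply: eq_bigr => c _.
by rewrite mulrAC.
Qed.

(* Lowering the index of the tension field by h avoids the inverse of h in the
   Christoffel symbols; T is the differential of h at f u. *)
Lemma tension_pairing m n (g : metric m) (h : metric n) (f : 'rV[R]_m -> 'rV[R]_n) u
    (sg L : 'I_m -> 'rV[R]_n) c (T : 'rV[R]_n -> 'rV[R]_n -> 'rV[R]_n -> R)
    (l : 'rV[R]_n) :
  invmx (g u) = c%:M ->
  (forall k i j, christoffel g u k i j = 0) ->
  (forall i a, 'D_('e_i) (fun v => f v 0 a) u = sg i 0 a) ->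
  (forall i a, 'D_('e_i) (fun v => 'D_('e_i) (fun w => f w 0 a) v) u = L i 0 a) ->
  (forall d a b, 'D_('e_d) (fun z => h z a b) (f u) = T 'e_d 'e_a 'e_b) ->
  trilinear T -> (forall d a b, T d a b = T d b a) ->
  (h (f u))^T = h (f u) -> h (f u) \in unitmx ->
  dotv (tension g h f u *m h (f u)) l =
    c * \sum_i (dotv (L i *m h (f u)) l + T (sg i) (sg i) l
                - 2^-1 * T l (sg i) (sg i)).
Proof.
move=> gu chr df d2f dh hT sT symh uh.
pose G i l := T (sg i) (sg i) l - 2^-1 * T l (sg i) (sg i).
have lG i : scalar (G i).
  move=> a v w; rewrite /G; have [h1 _ h3] := hT.
  by rewrite (h1 _ _ a v w) (h3 _ _ a v w); ring.
have chrh i a : \sum_b \sum_c christoffel h (f u) a b c *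
    sg i 0 b * sg i 0 c = \sum_k invmx (h (f u)) a k * G i 'e_k.
  (* The first two terms of the Christoffel symbol differ by exchanging b and c; contracted with
     [sg i] twice they contribute equally, and the halves add up. *)
  transitivity (\sum_b \sum_c \sum_k invmx (h (f u)) a k *
     (2^-1 * (T 'e_b 'e_c 'e_k * sg i 0 b * sg i 0 c)
      + 2^-1 * (T 'e_c 'e_b 'e_k * sg i 0 c * sg i 0 b)
      - 2^-1 * (T 'e_k 'e_b 'e_c * sg i 0 b * sg i 0 c))).
    apply: eq_bigr => b _; apply: eq_bigr => d _.
    rewrite /christoffel mulr_sumr 2!mulr_suml; apply: eq_bigr => k _.
    by rewrite !dh; ring.
  have -> (F : 'I_n -> 'I_n -> 'I_n -> R) :
      \sum_b \sum_c \sum_k F b c k = \sum_k \sum_b \sum_c F b c k.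
    rewrite exchange_big /=; transitivity (\sum_c \sum_k \sum_b F b c k).
      by apply: eq_bigr => d _; rewrite exchange_big.
    rewrite exchange_big /=; apply: eq_bigr => k _.
    by rewrite exchange_big.
  apply: eq_bigr => k _.
  have e1 : \sum_b \sum_d T 'e_d 'e_b 'e_k * sg i 0 d * sg i 0 b =
      T (sg i) (sg i) 'e_k by rewrite exchange_big /= trilinear_delta2.
  have := trilinear_delta2 (sg i) 'e_k hT; have := trilinear_delta3 (sg i) 'e_k hT.
  move=> e3 e2; rewrite /G -{1}(trilinear_delta2 (sg i) 'e_k hT).
  under eq_bigr do rewrite -mulr_sumr.
  rewrite -mulr_sumr; congr (_ * _).
  under eq_bigr do
    rewrite big_split /= big_split /= -mulr_sumr sumrN -mulr_sumr -mulr_sumr.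
  rewrite big_split /= big_split /= -mulr_sumr sumrN -mulr_sumr -mulr_sumr.
  by rewrite e1 e2 e3; field.
have tE : tension g h f u =
    c *: \sum_i (L i + (\row_k G i 'e_k) *m (invmx (h (f u)))^T).
  apply/rowP => a; rewrite mxE mxE summxE mulr_sumr; apply: eq_bigr => i _.
  rewrite (bigD1 i)//= [X in _ + X = _]big1 ?addr0 => [|j ji]; last first.
    by rewrite gu mxE eq_sym (negbTE ji) mul0r.
  rewrite gu mxE eqxx mulr1n; congr (_ * _); rewrite d2f big1 => [|k _]; last first.
    by rewrite chr mul0r.
  rewrite subr0 mxE; congr (_ + _).
  rewrite [RHS]mxE -[RHS](_ : \sum_k invmx (h (f u)) a k * G i 'e_k = _).
    by rewrite -chrh; apply: eq_bigr => b _; apply: eq_bigr => d _; rewrite !df.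
  by apply: eq_bigr => k _; rewrite !mxE mulrC.
rewrite tE -scalemxAl dotvZl mulmx_suml dotv_suml; congr (_ * _).
apply: eq_bigr => i _; rewrite mulmxDl dotvDl -[RHS]addrA; congr (_ + _).
rewrite -mulmxA trmx_inv symh mulVmx// mulmx1 dotvE -[RHS](scalar_delta l (lG i)).
by apply: eq_bigr => k _; rewrite mxE.
Qed.
End TensionPairing.

(** * The Kaluza-Klein metric in stereographic coordinates *)

Section KaluzaKlein.
Context {R : realType} (n : nat).
Implicit Types (x : 'rV[R]_n.+1) (E : 'M[R]_(n, n.+1)).
Implicit Types (u y a v w d : 'rV[R]_n) (B C : R -> R).

(* Gamma^k_ij(u) a^i y^j for the round metric. *)
Definition gamv u y a : 'rV[R]_n :=
  (- 2 / (1 + dotv u u)) *: (dotv u y *: a + dotv u a *: y - dotv a y *: u).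

Lemma vpartE x E z (w : 'rV[R]_(n + n)) : frame x E ->
  vpart (sphere_metric x E) z w =
    rsubmx w + gamv (lsubmx z) (rsubmx z) (lsubmx w).
Proof.
move=> fr; apply/rowP => k; rewrite [LHS]mxE [RHS]mxE; congr (_ + _).
move: (lsubmx z) (rsubmx z) (lsubmx w) => u y a {z w}.
transitivity (\sum_i \sum_j (- 2 / (1 + dotv u u)) *
   ((u 0 j * y 0 j) * a 0 i *+ (k == i) + (u 0 i * a 0 i) * y 0 j *+ (k == j)
    - u 0 k * (a 0 i * y 0 j) *+ (i == j))).
  apply: eq_bigr => i _; apply: eq_bigr => j _; rewrite christoffel_sphere//.
  by case: (k == i); case: (k == j); case: (i == j);
    rewrite ?mulr1n ?mulr0n; field; exact: dotv_add1_neq0.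
under eq_bigr do rewrite -mulr_sumr.
rewrite -mulr_sumr [RHS]mxE; congr (_ * _).
under eq_bigr do rewrite big_split /= sumrN big_split /=.
rewrite big_split /= sumrN big_split /= !mxE; congr (_ + _ - _).
- rewrite (bigD1 k)//= [X in _ + X]big1 ?addr0 => [|i ik]; last first.
    by rewrite big1// => j _; rewrite eq_sym (negbTE ik).
  by rewrite dotvE mulr_suml; apply: eq_bigr => j _; rewrite eqxx mulr1n.
- rewrite dotvE mulr_suml; apply: eq_bigr => i _.
  rewrite (bigD1 k)//= [X in _ + X]big1 ?addr0 => [|j jk]; last first.
    by rewrite eq_sym (negbTE jk).
  by rewrite eqxx mulr1n.
- rewrite dotvE mulrC mulr_sumr; apply: eq_bigr => i _.
  rewrite (bigD1 i)//= [X in _ + X]big1 ?addr0 => [|j ji]; last first.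
    by rewrite eq_sym (negbTE ji).
  by rewrite eqxx mulr1n.
Qed.

(** [B] and [C] are arguments so that they can be exchanged for extensions beyond [0, +oo[ before
    differentiating; u and y are separate so that they can vary independently. *)
Definition kkform B C u y a1 v1 a2 v2 : R :=
  let k1 := v1 + gamv u y a1 in let k2 := v2 + gamv u y a2 in
  let t := conf u * dotv y y in
  conf u * dotv a1 a2 + B t * (conf u * dotv k1 k2)
  + C t * (conf u * dotv k1 y) * (conf u * dotv k2 y).

Lemma kk_metricE B C x E z i j : frame x E ->
  kk_metric (fun=> 1) B C (sphere_metric x E) z i j =
    kkform B C (lsubmx z) (rsubmx z) (lsubmx 'e_i) (rsubmx 'e_i)
      (lsubmx 'e_j) (rsubmx 'e_j).
Proof.
move=> fr; rewrite mxE /kkform !vpartE// /hpart mul1r.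
have gip v w : (v *m sphere_metric x E (lsubmx z) *m w^T) 0 0 =
    conf (lsubmx z) * dotv v w.
  by rewrite sphere_metricE// mul_mx_scalar -scalemxAl mxE.
by rewrite !gip.
Qed.

(** Derivative of [gamv] at u = 0 when u moves along d. As [gamv] vanishes at u = 0 for every y, the
    variation of y does not contribute. *)
Definition dgamv y d a : 'rV[R]_n :=
  - 2 *: (dotv d y *: a + dotv d a *: y - dotv a y *: d).

(* The differential of kkform at (u, y) = (0, y) in the direction (d1, d2);
   b, c, b', c' are the values and derivatives of B and C at 4 |y|^2. *)
Definition dkkform b c b' c' y d1 d2 a1 v1 a2 v2 : R :=
  let m1 := dgamv y d1 a1 in let m2 := dgamv y d1 a2 in
  4 * b * (dotv m1 v2 + dotv v1 m2)
  + 32 * b' * dotv d2 y * dotv v1 v2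
  + 128 * c' * dotv d2 y * dotv v1 y * dotv v2 y
  + 16 * c * ((dotv m1 y + dotv v1 d2) * dotv v2 y
              + dotv v1 y * (dotv m2 y + dotv v2 d2)).

Lemma conf0 : conf (0 : 'rV[R]_n) = 4.
Proof. by rewrite /conf dotv0l addr0 expr1n divr1. Qed.

Lemma gamv0 y a : gamv 0 y a = 0.
Proof. by rewrite /gamv !dotv_lin !scale0r !scaler0 !(addr0, oppr0) scaler0. Qed.

Section Differential.
Context {V : normedModType R} (z0 dz : V).
Context (u y : V -> 'rV[R]_n) (y0 d1 d2 : 'rV[R]_n).
Hypothesis uz0 : u z0 = 0.
Hypothesis yz0 : y z0 = y0.
Hypothesis du : is_derive z0 dz u d1.
Hypothesis dy : is_derive z0 dz y d2.

Lemma is_derive_gamv a : is_derive z0 dz (fun z => gamv (u z) (y z) a)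
  (dgamv y0 d1 a).
Proof.
rewrite /gamv; derive_eq.
  by rewrite uz0 dotv0l addr0 oner_neq0.
rewrite uz0 yz0 /dgamv !dotv0l !dotv0r !addr0.
by apply/rowP => i; rewrite !mxE; field.
Qed.

Lemma is_derive_conf0 : is_derive z0 dz (fun z => conf (u z)) 0.
Proof.
apply: (is_derive_ext (f := fun z =>
    4 * ((1 + dotv (u z) (u z)) * (1 + dotv (u z) (u z)))^-1)).
  by move=> z; rewrite /conf expr2.
have n1 : (1 + dotv (u z0) (u z0)) * (1 + dotv (u z0) (u z0)) != 0.
  by rewrite mulf_neq0 ?dotv_add1_neq0.
derive_eq.
rewrite uz0 !dotv0l !dotv0r; ring.
Qed.

Lemma is_derive_kkform B C b' c' a1 v1 a2 v2 :
  is_derive (4 * dotv y0 y0) (1 : R) B b' ->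
  is_derive (4 * dotv y0 y0) (1 : R) C c' ->
  is_derive z0 dz (fun z => kkform B C (u z) (y z) a1 v1 a2 v2)
    (dkkform (B (4 * dotv y0 y0)) (C (4 * dotv y0 y0)) b' c' y0 d1 d2
       a1 v1 a2 v2).
Proof.
move=> hB hC.
have dc := is_derive_conf0; have g1 := is_derive_gamv a1.
have g2 := is_derive_gamv a2.
have hB' : is_derive (conf (u z0) * dotv (y z0) (y z0)) (1 : R) B b'.
  by rewrite uz0 conf0 yz0.
have hC' : is_derive (conf (u z0) * dotv (y z0) (y z0)) (1 : R) C c'.
  by rewrite uz0 conf0 yz0.
(* The conformal factor is stationary, so the squared length varies through y alone. The 8 found
   here, times the factors 4 and 4^2 of the metric, gives the 32 and 128 of [dkkform]. *)
have dt : is_derive z0 dz (fun z => conf (u z) * dotv (y z) (y z))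
    (8 * dotv d2 y0).
  by derive_eq; rewrite uz0 conf0 yz0 (dotvC y0); ring.
pose ft z : R := conf (u z) * dotv (y z) (y z).
have dB := is_derive_compf (f := ft) hB' dt.
have dC := is_derive_compf (f := ft) hC' dt.
rewrite /kkform; derive_eq.
rewrite uz0 yz0 !conf0 !gamv0 !addr0 /dkkform.
rewrite !dotv_lin !add0r (dotvC v2 d2) (dotvC v1 d2).
ring.
Qed.
End Differential.

Lemma is_derive_lsubmx (z d : 'rV[R]_(n + n)) : is_derive z d lsubmx (lsubmx d).
Proof.
apply/is_derive_mxP => i j; rewrite mxE.
apply: (is_derive_ext (f := fun t : 'rV[R]_(n + n) => t i (lshift n j))).
  by move=> t; rewrite mxE.
exact: is_derive_entry (is_derive_idf z d).
Qed.

Lemma is_derive_rsubmx (z d : 'rV[R]_(n + n)) : is_derive z d rsubmx (rsubmx d).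
Proof.
apply/is_derive_mxP => i j; rewrite mxE.
apply: (is_derive_ext (f := fun t : 'rV[R]_(n + n) => t i (rshift n j))).
  by move=> t; rewrite mxE.
exact: is_derive_entry (is_derive_idf z d).
Qed.

End KaluzaKlein.

(** * The metric and its differential as multilinear forms at the centre *)

Section Pairing.
Context {R : realType} (n : nat).
Implicit Types (y : 'rV[R]_n) (d v w : 'rV[R]_(n + n)).

Lemma is_derive_row_mx (V : normedModType R) (z e : V) (f g : V -> 'rV[R]_n) df dg :
  is_derive z e f df -> is_derive z e g dg ->
  is_derive z e (fun t => row_mx (f t) (g t)) (row_mx df dg).
Proof.
move=> /is_derive_mxP hf /is_derive_mxP hg; apply/is_derive_mxP => i j.
rewrite -(splitK j); case: (fintype.split j) => k /=.
  apply: (is_derive_ext (f := fun t => f t i k)); last by rewrite row_mxEl.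
  by move=> t; rewrite row_mxEl.
apply: (is_derive_ext (f := fun t => g t i k)); last by rewrite row_mxEr.
by move=> t; rewrite row_mxEr.
Qed.

(** The value of [kkform] at u = 0, where the conformal factor is 4 and lifts need no correction. *)
Definition kk0 b c y (v w : 'rV[R]_(n + n)) : R :=
  4 * dotv (lsubmx v) (lsubmx w) + 4 * b * dotv (rsubmx v) (rsubmx w)
  + 16 * c * dotv (rsubmx v) y * dotv (rsubmx w) y.

Definition dkk b c b' c' y (d v w : 'rV[R]_(n + n)) : R :=
  dkkform b c b' c' y (lsubmx d) (rsubmx d) (lsubmx v) (rsubmx v)
    (lsubmx w) (rsubmx w).

Lemma lsubmxP a (v w : 'rV[R]_(n + n)) :
  lsubmx (a *: v + w) = a *: lsubmx v + lsubmx w.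
Proof. exact: linearP. Qed.

Lemma rsubmxP a (v w : 'rV[R]_(n + n)) :
  rsubmx (a *: v + w) = a *: rsubmx v + rsubmx w.
Proof. exact: linearP. Qed.

Lemma kk0_linl b c y w : scalar (kk0 b c y ^~ w).
Proof. by move=> a u v; rewrite /kk0 lsubmxP rsubmxP !dotv_lin; ring. Qed.

Lemma kk0_linr b c y w : scalar (kk0 b c y w).
Proof. by move=> a u v; rewrite /kk0 lsubmxP rsubmxP !dotv_lin; ring. Qed.

Lemma dkk_trilinear b c b' c' y : trilinear (dkk b c b' c' y).
Proof.
split=> d v a u w; rewrite /dkk /dkkform /dgamv lsubmxP rsubmxP !dotv_lin; ring.
Qed.

Lemma dkk_sym b c b' c' y d v w : dkk b c b' c' y d v w = dkk b c b' c' y d w v.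
Proof.
rewrite /dkk /dkkform (dotvC (rsubmx v) (rsubmx w)).
rewrite (dotvC (rsubmx v) (dgamv _ _ _)) (dotvC (rsubmx w) (dgamv _ _ (lsubmx v))).
ring.
Qed.

Lemma kk0E b c y (H : 'M[R]_(n + n)) :
  (forall i j, H i j = kk0 b c y 'e_i 'e_j) ->
  forall v w, dotv (v *m H) w = kk0 b c y v w.
Proof.
move=> hH v w; rewrite dotvE.
rewrite -(scalar_delta w (kk0_linr b c y v)); apply: eq_bigr => j _.
congr (_ * _); rewrite mxE -(scalar_delta v (kk0_linl b c y 'e_j)).
by apply: eq_bigr => i _; rewrite hH mulrC.
Qed.

Lemma kk0_nondegenerate b c y v : 0 < b -> 0 < b + 4 * dotv y y * c ->
  (forall w, kk0 b c y v w = 0) -> v = 0.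
Proof.
move=> b0 bc h; rewrite -[v]hsubmxK.
have l0 : lsubmx v = 0.
  apply/eqP; rewrite -dotv_eq0; apply/eqP.
  have := h (row_mx (lsubmx v) 0).
  by rewrite /kk0 row_mxKl row_mxKr !dotv_lin; lra.
(* Testing against the vertical vector y produces the factor b + t c with t = 4 |y|^2; once this
   product is 0 the term in c disappears. *)
have vy : dotv (rsubmx v) y = 0.
  have := h (row_mx 0 y); rewrite /kk0 row_mxKl row_mxKr !dotv_lin => e.
  have : 4 * (b + 4 * dotv y y * c) * dotv (rsubmx v) y = 0 by rewrite -e; ring.
  by move/eqP; rewrite !mulf_eq0 (gt_eqF bc) pnatr_eq0 => /eqP.
have r0 : rsubmx v = 0.
  apply/eqP; rewrite -dotv_eq0; apply/eqP.
  have := h (row_mx 0 (rsubmx v)).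
  rewrite /kk0 row_mxKl row_mxKr !dotv_lin vy => e.
  have : 4 * b * dotv (rsubmx v) (rsubmx v) = 0 by rewrite -e; ring.
  by move/eqP; rewrite !mulf_eq0 (gt_eqF b0) pnatr_eq0 => /eqP.
by rewrite l0 r0 row_mx0.
Qed.

Lemma kk0_unitmx b c y (H : 'M[R]_(n + n)) : 0 < b -> 0 < b + 4 * dotv y y * c ->
  (forall i j, H i j = kk0 b c y 'e_i 'e_j) -> H \in unitmx.
Proof.
move=> b0 bc hH; rewrite -row_free_unit -kermx_eq0; apply/eqP/row_matrixP => i.
rewrite row0; apply: (kk0_nondegenerate b0 bc) => w; rewrite -(kk0E hH).
have /sub_kermxP -> : (row i (kermx H) <= kermx H)%MS by exact: row_sub.
by rewrite dotv0l.
Qed.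

End Pairing.

(** * Traces over the coordinate frame *)

Section TensionFields.
Context {R : realType} (n : nat).
Implicit Types (y w l : 'rV[R]_n).

Lemma sum_dotv_delta (v w : 'rV[R]_n) :
  \sum_i dotv 'e_i v * dotv 'e_i w = dotv v w.
Proof.
by rewrite dotvE; apply: eq_bigr => i _; rewrite !(dotvC 'e_i) !dotv_delta.
Qed.

Lemma dotv_delta1 i : dotv ('e_i) ('e_i : 'rV[R]_n) = 1.
Proof. by rewrite dotv_delta mxE !eqxx. Qed.

Section Sums.
Variables (y l : 'rV[R]_n) (Om : 'M[R]_n).
Hypothesis skOm : Om^T = - Om.

(* The i-th partial derivative of the section and of its differential at the
   centre of the chart, when the section has value y and linear part Om. *)
Definition dsec i : 'rV[R]_(n + n) := row_mx ('e_i) ('e_i *m Om).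
Definition d2sec i : 'rV[R]_(n + n) :=
  row_mx 0 (- (2 *: y) + (4 * dotv 'e_i y) *: 'e_i).

(** Skewness moves [Om] off e_i, each summand becomes a product of two coordinates, and Parseval
    applies. In 1 - n, the n counts equal summands and the 1 is the trace of the terms along e_i.
    The sum of squared rows is the squared norm of the covariant derivative. *)
Lemma kk_vertical_sum b c b' c' :
  \sum_i (kk0 b c y (d2sec i) (row_mx 0 l)
    + dkk b c b' c' y (dsec i) (dsec i) (row_mx 0 l)
    - 2^-1 * dkk b c b' c' y (row_mx 0 l) (dsec i) (dsec i)) =
  16 * ((1 - n%:R) * (b + 4 * dotv y y * c)
     + 4 * c' * dotv (y *m Om) (y *m Om)
     + (c - b') * \sum_i dotv (row i Om) (row i Om)) * dotv y l
  + 32 * b' * dotv (y *m Om) (l *m Om).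
Proof.
have wE i v : dotv ('e_i *m Om) v = - dotv 'e_i (v *m Om) by exact: skew_dotv.
transitivity (\sum_i (16 * b * (dotv 'e_i y * dotv 'e_i l)
  + 64 * c * dotv y l * (dotv 'e_i y * dotv 'e_i y)
  + 32 * b' * (dotv 'e_i (y *m Om) * dotv 'e_i (l *m Om))
  + 64 * c' * dotv y l * (dotv 'e_i (y *m Om) * dotv 'e_i (y *m Om))
  + 16 * (c - b') * dotv y l * dotv (row i Om) (row i Om)
  - 16 * (b + 4 * dotv y y * c) * dotv y l)).
  apply: eq_bigr => i _; rewrite /dsec /d2sec /kk0 /dkk /dkkform /dgamv.
  rewrite !row_mxKl !row_mxKr !dotv_lin rowE dotv_delta1 (dotvC l).
  rewrite (wE i y) (wE i l) (dotvC l ('e_i *m Om)) (wE i l).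
  by field.
rewrite sumrB !big_split /= -!mulr_sumr !sum_dotv_delta sumr_const card_ord.
by rewrite -[_ *+ n]mulr_natr; ring.
Qed.

(** Every surviving term comes from [dgamv], that is from curvature, and those in c cancel. y Om is
    the covariant derivative of the field along itself. *)
Lemma kk_horizontal_sum b c b' c' :
  \sum_i (kk0 b c y (d2sec i) (row_mx l 0)
    + dkk b c b' c' y (dsec i) (dsec i) (row_mx l 0)
    - 2^-1 * dkk b c b' c' y (row_mx l 0) (dsec i) (dsec i)) =
  - 16 * b * dotv (y *m Om) l.
Proof.
have wE i v : dotv ('e_i *m Om) v = - dotv 'e_i (v *m Om) by exact: skew_dotv.
transitivity (\sum_i 16 * b * (dotv 'e_i y * dotv 'e_i (l *m Om))).
  apply: eq_bigr => i _; rewrite /dsec /d2sec /kk0 /dkk /dkkform /dgamv.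
  rewrite !row_mxKl !row_mxKr !dotv_lin dotv_delta1 (dotvC l 'e_i).
  rewrite (dotvC 'e_i ('e_i *m Om)) (skew_dotvv 'e_i skOm).
  rewrite ?(dotvC l ('e_i *m Om)) ?(dotvC y ('e_i *m Om)) (wE i l).
  by field.
rewrite -mulr_sumr sum_dotv_delta (skew_dotv y l skOm); ring.
Qed.
End Sums.
End TensionFields.

(** * The tension field of a rotation field at the centre of a chart *)

Section SectionTension.
Context {R : realType} (n : nat).
Variables (x : 'rV[R]_n.+1) (E : 'M[R]_(n, n.+1)).
Variables (xi : 'rV[R]_n.+1 -> 'rV[R]_n.+1) (W : 'M[R]_n.+1).
Hypothesis fr : frame x E.
Hypothesis skW : W^T = - W.
Hypothesis xiW : forall y, sphere y -> xi y = y *m W.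

Let b := x *m W *m E^T.
Let Om := E *m W *m E^T.
Let y := 2^-1 *: b.

Lemma tangential_skew : Om^T = - Om.
Proof. by rewrite /Om !trmx_mul trmxK skW mulNmx mulmxN mulmxA. Qed.

Lemma section_map0 : section_map xi x E 0 = row_mx 0 y.
Proof.
rewrite /section_map (coord_field_linear 0 fr skW xiW) -/b -/Om.
by rewrite !dotv0l mul0mx !scaler0 !addr0 subr0 scale1r.
Qed.

Definition dsection (u v : 'rV[R]_n) : 'rV[R]_(n + n) :=
  row_mx v (2^-1 *: ((- (2 * dotv u v)) *: b + 2 *: (v *m Om)
    + ((2 * dotv v b) *: u + (2 * dotv u b) *: v))).

Lemma is_derive_section_map (u v : 'rV[R]_n) :
  is_derive u v (section_map xi x E) (dsection u v).
Proof.
apply: (is_derive_ext (f := fun u => row_mx u (2^-1 *: ((1 - dotv u u) *: b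
    + 2 *: (u *m Om) + (2 * dotv u b) *: u)))).
  by move=> w; rewrite /section_map (coord_field_linear w fr skW xiW).
notypeclasses refine (is_derive_row_mx (is_derive_idf _ _) _).
derive_eq.
by rewrite (dotvC v u) dotv0r; apply/rowP => i; rewrite !mxE; ring.
Qed.

Lemma is_derive_dsection i :
  is_derive 0 'e_i (fun v => dsection v 'e_i) (d2sec y i).
Proof.
notypeclasses refine (is_derive_row_mx (is_derive_cstf _ _ _) _).
derive_eq.
by rewrite dotv_delta1 !dotv0l; apply/rowP => j; rewrite /y !mxE dotvZr; field.
Qed.

(** [FB] and [FC] stand for differentiable extensions: t is 0 where xi vanishes, and a two-sided
    derivative of [B] there would see its arbitrary values at negative arguments. *)
Variables (B C FB FC : R -> R) (b' c' : R).
Local Notation t := (dotv b b).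
Hypothesis BE : forall s, 0 <= s -> FB s = B s.
Hypothesis CE : forall s, 0 <= s -> FC s = C s.
Hypothesis dFB : is_derive t (1 : R) FB b'.
Hypothesis dFC : is_derive t (1 : R) FC c'.
Hypothesis B0 : 0 < B t.
Hypothesis BC0 : 0 < B t + t * C t.

Lemma yy : 4 * dotv y y = t.
Proof. by rewrite /y !dotv_lin; field. Qed.

Lemma section_tension_pairing l :
  kk0 (B t) (C t) y (section_tension (fun=> 1) B C xi x E 0) l =
  4^-1 * \sum_i (kk0 (B t) (C t) y (d2sec y i) l
    + dkk (B t) (C t) b' c' y (dsec Om i) (dsec Om i) l
    - 2^-1 * dkk (B t) (C t) b' c' y l (dsec Om i) (dsec Om i)).
Proof.
set g := sphere_metric x E.
set h := kk_metric (fun=> 1) B C g.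
set f := section_map xi x E.
have hE i j : h (f 0) i j = kk0 (B t) (C t) y 'e_i 'e_j.
  rewrite /h /f section_map0 kk_metricE// row_mxKl row_mxKr /kkform conf0.
  by rewrite !gamv0 !addr0 yy /kk0; ring.
have dh (d i j : 'I_(n + n)) : 'D_('e_d) (fun z => h z i j) (f 0) =
    dkk (B t) (C t) b' c' y 'e_d 'e_i 'e_j.
  (* The metric evaluates B and C at squared lengths only, so exchanging them for their extensions
     changes nothing. *)
  apply: is_derive_val; rewrite -BE ?dotv_ge0// -CE ?dotv_ge0// -yy.
  apply: (is_derive_ext (f := fun z => kkform FB FC (lsubmx z) (rsubmx z)
      (lsubmx 'e_i) (rsubmx 'e_i) (lsubmx 'e_j) (rsubmx 'e_j))).
    move=> z; rewrite kk_metricE// /kkform BE ?CE// mulr_ge0 ?dotv_ge0//;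
      by rewrite ltW ?conf_gt0.
  apply: is_derive_kkform; rewrite ?yy//.
  - by rewrite /f section_map0 row_mxKl.
  - by rewrite /f section_map0 row_mxKr.
  - exact: is_derive_lsubmx.
  - exact: is_derive_rsubmx.
have symh : (h (f 0))^T = h (f 0).
  apply/matrixP => i j; rewrite mxE !hE /kk0.
  by rewrite (dotvC (lsubmx 'e_j)) (dotvC (rsubmx 'e_j) (rsubmx 'e_i)); ring.
have uh : h (f 0) \in unitmx.
  by apply: (kk0_unitmx B0 _ hE); rewrite yy.
rewrite -(kk0E hE).
rewrite (@tension_pairing R _ _ g h f 0 (dsec Om) (d2sec y) 4^-1
  (dkk (B t) (C t) b' c' y) l) //.
- by congr (_ * _); apply: eq_bigr => i _; rewrite (kk0E hE).
- by rewrite /g invmx_metric// conf0.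
- move=> k i j; rewrite /g christoffel_sphere//.
  by rewrite !mxE !mul0rn addr0 subrr mulr0.
- move=> i a; apply: is_derive_val.
  apply: is_derive_eq (is_derive_entry 0 a (is_derive_section_map 0 'e_i)) _.
  congr (row_mx _ _ 0 a).
  rewrite !dotv0l !mulr0 oppr0 !scale0r add0r scaler0 !addr0 scalerA.
  by rewrite mulVf ?scale1r// pnatr_eq0.
- move=> i a; apply: is_derive_val.
  rewrite (_ : (fun v => _) = fun v => dsection v 'e_i 0 a).
    exact: is_derive_entry (is_derive_dsection i).
  apply/funext => v; apply: is_derive_val.
  exact: is_derive_entry (is_derive_section_map v 'e_i).
- exact: dkk_trilinear.
- exact: dkk_sym.
Qed.

Lemma tension_vE : tension_v (fun=> 1) B C xi x E =
  rsubmx (section_tension (fun=> 1) B C xi x E 0).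
Proof.
by rewrite /tension_v vpartE// section_map0 row_mxKl gamv0 addr0.
Qed.

Lemma tension_h_eq0 : tension_h (fun=> 1) B C xi x E = 0 <-> b *m Om = 0.
Proof.
rewrite /tension_h /hpart; set T := section_tension _ _ _ _ _ _ _.
have e l : 4 * dotv (lsubmx T) l = - 4 * B t * dotv (y *m Om) l.
  have := section_tension_pairing (row_mx l 0).
  rewrite kk_horizontal_sum ?tangential_skew// -/T /kk0 row_mxKl row_mxKr.
  by rewrite !dotv_lin; lra.
have yb : y *m Om = 2^-1 *: (b *m Om) by rewrite -scalemxAl.
split=> [T0|bO].
  apply: eq_dotv => l; rewrite dotv0l.
  have := e l; rewrite T0 dotv0l mulr0 yb dotvZl => /esym/eqP.
  rewrite !mulf_eq0 (gt_eqF B0) invr_eq0 oppr_eq0 !pnatr_eq0 /=.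
  by move/eqP.
apply: eq_dotv => l; have := e l.
by rewrite yb bO scaler0 !dotv0l mulr0; lra.
Qed.

Lemma tension_v_eq0 : tension_v (fun=> 1) B C xi x E = 0 <->
  ((1 - n%:R) * (B t + t * C t) + c' * dotv (b *m Om) (b *m Om)
    + (C t - b') * \sum_i dotv (row i Om) (row i Om)) *: b
  - (2 * b') *: (b *m Om *m Om) = 0.
Proof.
rewrite tension_vE; set T := section_tension _ _ _ _ _ _ _.
set N := \sum_i _; set V := (X in _ <-> X = 0).
have e l : 4 * B t * dotv (rsubmx T) l +
    16 * C t * dotv (rsubmx T) y * dotv l y = 2 * dotv V l.
  have := section_tension_pairing (row_mx 0 l).
  rewrite kk_vertical_sum ?tangential_skew// -/T /kk0 row_mxKl row_mxKr -/N yy.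
  rewrite dotv0r mulr0 add0r => ->.
  have -> : y *m Om = 2^-1 *: (b *m Om) by rewrite -scalemxAl.
  by rewrite /V !dotv_lin (skew_dotv (b *m Om) l tangential_skew); field.
split=> [T0|V0].
  apply: (@eq_dotv _ _ V 0) => l; rewrite dotv0l.
  by have := e l; rewrite T0 !dotv0l; lra.
suff : row_mx 0 (rsubmx T) = 0 :> 'rV[R]_(n + n).
  by move/(congr1 rsubmx); rewrite row_mxKr => ->; rewrite linear0.
apply: (kk0_nondegenerate (b := B t) (c := C t) (y := y)) => //.
  by rewrite yy.
move=> w; rewrite /kk0 row_mxKl row_mxKr dotv0l mulr0 add0r e V0.
by rewrite dotv0l mulr0.
Qed.
End SectionTension.

(** * The harmonic section equation in the ambient space *)

Section Criterion.
Context {R : realType}.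

(** The derivatives of F and f are compared for t > 0 only; at 0 that of f may differ or fail to
    exist. *)
Lemma C2_nonneg_ext (f : R -> R) : C2_nonneg f ->
  exists F : R -> R, [/\ forall t : R, 0 <= t -> F t = f t,
    forall t : R, 0 <= t -> is_derive t (1 : R) F (derive1 F t),
    forall t : R, 0 < t -> derive1 F t = derive1 f t &
    forall t : R, 0 < t -> {for t, continuous (derive1 f)}].
Proof.
move=> [eps [F [eps0 Ff dF d2F _]]].
have e (t : R) : 0 < t -> \near t, F t = f t.
  by move=> t0; near=> s; apply: Ff; rewrite ltW//; near: s; exact: lt_nbhsr.
have dE (t : R) : 0 < t -> derive1 F t = derive1 f t.
  by move=> t0; rewrite !derive1E; apply: near_eq_derive; exact: e.
exists F; split; [exact: Ff| |exact: dE|] => t t0.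
  rewrite derive1E; apply: derivableP; apply: dF; lra.
apply: differentiable_continuous; apply/derivable1_diffP.
apply: (@near_eq_derivable _ _ _ (derive1 F)); last by apply: d2F; lra.
by near=> s; apply: dE; near: s; exact: lt_nbhsr.
Unshelve. all: by end_near. Qed.

(** Tests definiteness at |e|^2 = t on V orthogonal to e, which takes two tangent dimensions, and on
    V = e. For t = 0 the second vector is zero, but then both claims coincide. *)
Lemma kaluza_klein_pos n (B C : R -> R) (t : R) : (1 < n)%N -> 0 <= t ->
  kaluza_klein n (fun=> 1) B C -> 0 < B t /\ 0 < B t + t * C t.
Proof.
move=> n1 t0 [_ _ _ _ pos].
have hx : sphere ('e_ord0 : 'rV[R]_n.+1) by exact: dotv_delta1.
have [E fr] := exists_frame hx.
have dE (v w : 'rV[R]_n) := frame_dotE v w fr.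
have tE (v : 'rV[R]_n) := frame_dot0 v fr.
pose a : 'rV[R]_n := 'e_(Ordinal (ltnW n1)); pose b : 'rV[R]_n := 'e_(Ordinal n1).
have aa : dotv a a = 1 by exact: dotv_delta1.
have bb : dotv b b = 1 by exact: dotv_delta1.
have ba : dotv b a = 0 by rewrite dotv_delta mxE.
have nz (v : 'rV[R]_n) : dotv v v != 0 -> v *m E != 0.
  by rewrite -dE dotv_eq0.
have st : Num.sqrt t * Num.sqrt t = t by rewrite -expr2 sqr_sqrtr.
have Bt : 0 < B t.
  have := pos _ ((Num.sqrt t *: a) *m E) 0 (b *m E) hx (tE _) (dotv0l _) (tE _).
  rewrite (nz b) ?bb ?oner_neq0// orbT => /(_ isT).
  by rewrite !dE !dotv_lin aa bb ba !mulr1 st; lra.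
split => //; have [t00|tn0] := eqVneq t 0.
  by rewrite {2}t00 mul0r addr0.
have := pos _ ((Num.sqrt t *: a) *m E) 0 ((Num.sqrt t *: a) *m E)
  hx (tE _) (dotv0l _) (tE _).
rewrite (nz (Num.sqrt t *: a)) ?orbT; last by rewrite !dotv_lin aa !mulr1 st.
move=> /(_ isT); rewrite !dE !dotv_lin aa !mulr1 st => h.
have tp : 0 < t by rewrite lt_def tn0.
rewrite -(pmulr_rgt0 _ tp).
have -> : t * (B t + t * C t) = B t * t + C t * t ^+ 2 by ring.
by move: h; rewrite mulr0 add0r.
Qed.

Section Ambient.
Context (n : nat) (x : 'rV[R]_n.+1) (E : 'M[R]_(n, n.+1)) (W : 'M[R]_n.+1).
Hypothesis fr : frame x E.
Hypothesis skW : W^T = - W.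
Let b := x *m W *m E^T.
Let Om := E *m W *m E^T.
Local Notation t := (dotv (x *m W) (x *m W)).

Lemma frame_mulEE v : v *m E^T *m E = v - dotv v x *: x.
Proof.
by rewrite -mulmxA (frame_tr fr) mulmxBr mulmx1 mulmx_outer.
Qed.

Lemma frame_dotET v : dotv (v *m E^T) (v *m E^T) = dotv v v - dotv v x ^+ 2.
Proof.
by rewrite dotv_mul trmxK frame_mulEE !dotv_lin expr2.
Qed.

Lemma ambient_norm : dotv b b = t.
Proof. by rewrite /b frame_dotET (skew_dotvv x skW) expr0n subr0. Qed.

Lemma ambient_mul : b *m Om = x *m W *m W *m E^T.
Proof.
by rewrite /b /Om !mulmxA frame_mulEE (skew_dotvv x skW) scale0r subr0.
Qed.

Lemma ambient_dotWW : dotv (x *m W *m W) x = - t.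
Proof. by rewrite (skew_dotv _ _ skW). Qed.

Lemma ambient_mul_norm : dotv (b *m Om) (b *m Om) =
  dotv (x *m W *m W) (x *m W *m W) - t ^+ 2.
Proof. by rewrite ambient_mul frame_dotET ambient_dotWW sqrrN. Qed.

Lemma ambient_mul2 : b *m Om *m Om = x *m W *m W *m W *m E^T + t *: b.
Proof.
rewrite ambient_mul /Om !mulmxA frame_mulEE ambient_dotWW mulmxBl mulmxBl.
by rewrite scaleNr !mulNmx opprK -!scalemxAl.
Qed.

(** Compressing W to the tangent space deletes the row and the column of x, each of squared norm
    t. *)
Lemma ambient_trace : \sum_i dotv (row i Om) (row i Om) =
  - \tr (W *m W) - 2 * t.
Proof.
have xx (A : 'M[R]_n.+1) : \tr (A *m x^T *m x) = dotv (x *m A) x.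
  by rewrite mxtrace_mulC /dotv mulmxA [\tr _]big_ord1.
have -> : \sum_i dotv (row i Om) (row i Om) = - \tr (Om *m Om).
  rewrite -raddfN /= -mulmxN -(tangential_skew E skW); apply: eq_bigr => i _.
  by rewrite dotvE mxE; apply: eq_bigr => j _; rewrite !mxE.
have -> : \tr (Om *m Om) = \tr (W *m (E^T *m E) *m W *m (E^T *m E)).
  by rewrite /Om -!mulmxA mxtrace_mulC -!mulmxA.
have x0 : x *m W *m x^T = 0.
  by apply/matrixP => i j; rewrite !ord1 [RHS]mxE -[RHS](skew_dotvv x skW).
have -> : \tr (W *m (E^T *m E) *m W *m (E^T *m E)) =
    \tr (W *m W) - \tr (W *m W *m x^T *m x) - \tr (W *m W *m x^T *m x).
  rewrite (frame_tr fr) !mulmxBr !mulmx1 !mulmxBl !raddfB /=.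
  rewrite [\tr (W *m (x^T *m x) *m W)]mxtrace_mulC !mulmxA.
  by rewrite -(mulmxA _ x W) -(mulmxA _ (x *m W)) x0 mulmx0 mul0mx raddf0 opprK addr0.
by rewrite xx mulmxA ambient_dotWW; ring.
Qed.
End Ambient.

(** In ambient form the two contributions 2 t B', one from the trace and one from the projection of
    x W^3, cancel. *)
Lemma harmonic_section_criterion n (xi : 'rV[R]_n.+1 -> 'rV[R]_n.+1) W
    (B C : R -> R) : (1 < n)%N -> W^T = - W ->
  (forall y, sphere y -> xi y = y *m W) -> kaluza_klein n (fun=> 1) B C ->
  harmonic_section (fun=> 1) B C xi <->
  forall x, sphere x -> let t := dotv (x *m W) (x *m W) in 0 < t ->
   ((1 - n%:R) * (B t + t * C t)
    + derive1 C t * (dotv (x *m W *m W) (x *m W *m W) - t ^+ 2)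
    - (C t - derive1 B t) * \tr (W *m W) - 2 * t * C t) *: (x *m W)
   - (2 * derive1 B t) *: (x *m W *m W *m W) = 0.
Proof.
move=> n1 skW xiW kk; have [_ cB cC _ _] := kk.
have [FB [BE dB B1 _]] := C2_nonneg_ext cB.
have [FC [CE dC C1 _]] := C2_nonneg_ext cC.
pose V x b' c' : 'rV[R]_n.+1 := let t := dotv (x *m W) (x *m W) in
   ((1 - n%:R) * (B t + t * C t)
    + c' * (dotv (x *m W *m W) (x *m W *m W) - t ^+ 2)
    - (C t - b') * \tr (W *m W) - 2 * t * C t) *: (x *m W)
   - (2 * b') *: (x *m W *m W *m W).
have key x E : frame x E -> tension_v (fun=> 1) B C xi x E = 0 <->
    V x (derive1 FB (dotv (x *m W) (x *m W)))
      (derive1 FC (dotv (x *m W) (x *m W))) = 0.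
  move=> fr; set t := dotv (x *m W) (x *m W).
  have t0 : 0 <= t by exact: dotv_ge0.
  have [Bt BCt] := kaluza_klein_pos n1 t0 kk.
  have nb : dotv (x *m W *m E^T) (x *m W *m E^T) = t := ambient_norm fr skW.
  have := @tension_v_eq0 R n x E xi W fr skW xiW B C FB FC
    (derive1 FB t) (derive1 FC t) BE CE.
  rewrite nb => /(_ (dB t t0) (dC t t0) Bt BCt) ->.
  rewrite (ambient_mul_norm fr skW) (ambient_mul2 fr skW) (ambient_trace fr skW).
  rewrite -/t.
  set v := (X in X = 0 <-> _); set w := V _ _ _.
  have -> : v = w *m E^T.
    rewrite /v /w /V -/t mulmxBl -!scalemxAl scalerDr opprD addrA addrAC.
    by rewrite scalerA -scalerBl; congr (_ *: _ - _); ring.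
  (* The ambient expression is tangent at x, so it vanishes as soon as its coordinates in the frame
     do. *)
  have wx : dotv w x = 0.
    rewrite /w /V !dotv_lin (skew_dotvv x skW) (skew_dotv _ x skW).
    by rewrite (skew_dotvv (x *m W) skW); ring.
  split=> [w0|->]; last by rewrite mul0mx.
  by rewrite -(tangent_frame fr wx) w0 mul0mx.
split=> [h x hx /= t0|h x E fr].
  have [E fr] := exists_frame hx.
  by move/(key x E fr): (h x E fr); rewrite /V B1// C1.
apply/(key x E fr); have [t0|t0] := boolP (0 < dotv (x *m W) (x *m W)).
  by have [hx _ _] := fr; rewrite /V B1// C1//; exact: h.
rewrite dotv_gt0 negbK in t0.
by rewrite /V (eqP t0) !mul0mx !scaler0 subr0.
Qed.

Lemma harmonic_map_criterion n (xi : 'rV[R]_n.+1 -> 'rV[R]_n.+1) W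
    (B C : R -> R) : (1 < n)%N -> W^T = - W ->
  (forall y, sphere y -> xi y = y *m W) -> kaluza_klein n (fun=> 1) B C ->
  harmonic_map (fun=> 1) B C xi <->
  harmonic_section (fun=> 1) B C xi /\
  forall x, sphere x -> x *m W *m W = - dotv (x *m W) (x *m W) *: x.
Proof.
move=> n1 skW xiW kk; have [_ cB cC _ _] := kk.
have [FB [BE dB B1 _]] := C2_nonneg_ext cB.
have [FC [CE dC C1 _]] := C2_nonneg_ext cC.
have key x E : frame x E -> tension_h (fun=> 1) B C xi x E = 0 <->
    x *m W *m W = - dotv (x *m W) (x *m W) *: x.
  move=> fr; set t := dotv (x *m W) (x *m W).
  have t0 : 0 <= t by exact: dotv_ge0.
  have [Bt BCt] := kaluza_klein_pos n1 t0 kk.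
  have nb : dotv (x *m W *m E^T) (x *m W *m E^T) = t := ambient_norm fr skW.
  have := @tension_h_eq0 R n x E xi W fr skW xiW B C FB FC
    (derive1 FB t) (derive1 FC t) BE CE.
  rewrite nb => /(_ (dB t t0) (dC t t0) Bt BCt) ->.
  rewrite (ambient_mul fr skW); split=> [h|->].
    have := frame_mulEE fr (x *m W *m W).
    rewrite h mul0mx (ambient_dotWW x skW) => /esym/eqP; rewrite subr_eq0.
    by move/eqP.
  have [_ _ h] := fr; rewrite -scalemxAl (_ : x *m E^T = 0) ?scaler0//.
  by rewrite -[LHS]trmxK trmx_mul trmxK h trmx0.
split=> [h|[h1 h2] x E fr].
  split=> [x E fr|x hx]; first by case: (h x E fr).
  by have [E fr] := exists_frame hx; apply/(key x E fr); case: (h x E fr).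
by split; [apply/(key x E fr)/h2; case: fr|exact: h1].
Qed.
End Criterion.

(** * Explicit profiles *)

Section Examples.
Context {R : realType}.

Lemma C2_nonneg_is_derive (f f1 f2 : R -> R) (eps : R) : 0 < eps ->
  (forall t : R, - eps < t -> is_derive t (1 : R) f (f1 t)) ->
  (forall t : R, - eps < t -> is_derive t (1 : R) f1 (f2 t)) ->
  (forall t : R, - eps < t -> derivable f2 t 1) ->
  C2_nonneg f.
Proof.
move=> eps0 d1 d2 d3; exists eps, f.
have e1 (t : R) : - eps < t -> derive1 f t = f1 t.
  by move=> te; rewrite derive1E; have := d1 t te; case.
have n1 (t : R) : - eps < t -> \near t, f1 t = derive1 f t.
  by move=> te; near=> s; rewrite e1//; near: s; exact: lt_nbhsr.
have e2 (t : R) : - eps < t -> derive1 (derive1 f) t = f2 t.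
  move=> te; rewrite derive1E -(near_eq_derive _ (n1 t te)).
  by have := d2 t te; case.
have n2 (t : R) : - eps < t -> \near t, f2 t = derive1 (derive1 f) t.
  by move=> te; near=> s; rewrite e2//; near: s; exact: lt_nbhsr.
split; [by []|by []| | |] => t te.
- by have := d1 t te; case.
- by apply: (near_eq_derivable (n1 t te)); have := d2 t te; case.
- apply: differentiable_continuous; apply/derivable1_diffP.
  exact: (near_eq_derivable (n2 t te)) (d3 t te).
Unshelve. all: by end_near. Qed.

Lemma is_derive_scale_expR (K c : R) (t : R) :
  is_derive t (1 : R) (fun t => K * expR (c * t)) (K * c * expR (c * t)).
Proof.
have d := is_derive_mulf (is_derive_cstf t (1 : R) c) (is_derive_idf t (1 : R)).
have := is_derive_compf (f := fun t : R => c * t) (is_derive_expR (c * t)) d.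
move=> /(is_derive_mulf (is_derive_cstf t (1 : R) K)) d'.
by apply: is_derive_eq d' _; ring.
Qed.

Lemma C2_nonneg_expR (K c : R) : C2_nonneg (fun t => K * expR (c * t)).
Proof.
apply: (@C2_nonneg_is_derive _ (fun t => K * c * expR (c * t))
  (fun t => K * c * c * expR (c * t)) 1) => [|t _|t _|t _];
  [exact: ltr01|exact: is_derive_scale_expR|exact: is_derive_scale_expR|].
by have := is_derive_scale_expR (K * c * c) c t; case.
Qed.

Lemma is_derive_scale_powR (K c : R) (t : R) : -1 < t ->
  is_derive t (1 : R) (fun t => K * (1 + t) `^ c) (K * c * (1 + t) `^ (c - 1)).
Proof.
move=> t1; have t0 : 0 < 1 + t by lra.
have d := is_derive_addf (is_derive_cstf t (1 : R) (1 : R)) (is_derive_idf t (1 : R)).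
have := is_derive_compf (f := fun t : R => 1 + t) (is_derive1_powR c t0) d.
move=> /(is_derive_mulf (is_derive_cstf t (1 : R) K)) d'.
by apply: is_derive_eq d' _; ring.
Qed.

Lemma C2_nonneg_powR (K c : R) : C2_nonneg (fun t => K * (1 + t) `^ c).
Proof.
apply: (@C2_nonneg_is_derive _ (fun t => K * c * (1 + t) `^ (c - 1))
  (* The margin is 1 because the base 1 + t must remain positive. *)
  (fun t => K * c * (c - 1) * (1 + t) `^ (c - 1 - 1)) 1) => [|t t1|t t1|t t1];
  [exact: ltr01|exact: is_derive_scale_powR|exact: is_derive_scale_powR|].
by have := is_derive_scale_powR (K * c * (c - 1)) (c - 1 - 1) t1; case.
Qed.

Lemma C2_nonneg_cst (c : R) : C2_nonneg (fun=> c).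
Proof.
have d (a t : R) := is_derive_cstf t (1 : R) a.
refine (C2_nonneg_is_derive (f1 := fun=> 0) (f2 := fun=> 0) ltr01
  (fun t _ => d c t) (fun t _ => d 0 t) (fun t _ => _)).
exact: derivable_cst.
Qed.

Lemma kaluza_klein_C0 n (B : R -> R) : C2_nonneg B -> (forall t, 0 <= t -> 0 < B t) ->
  kaluza_klein n (fun=> 1) B (fun=> 0).
Proof.
move=> cB Bp; split=> //; [exact: C2_nonneg_cst|exact: C2_nonneg_cst|].
move=> x e X V _ _ _ _ XV; rewrite mul0r addr0 mul1r.
have Be := Bp _ (dotv_ge0 e).
case/orP: XV => nz; last by rewrite ltr_wpDl ?dotv_ge0// mulr_gt0// dotv_gt0.
by rewrite ltr_pwDl ?dotv_gt0// mulr_ge0 ?dotv_ge0// ltW.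
Qed.
End Examples.

(** * Planes of rotation and the flow *)

Section RotationBasis.
Context {R : realType}.

(** Speeds of any sign and zero speeds are allowed: the kernel of W is cut into planes as well, and
    the constant of a rotation form may be negative. *)
Definition rotation_basis m (W : 'M[R]_m) q (f : nat -> 'rV[R]_m)
    (nu : nat -> R) :=
  orthonormal_family m f /\ forall i, (i < q)%N ->
    f i.*2 *m W = nu i *: f i.*2.+1 /\ f i.*2.+1 *m W = - nu i *: f i.*2.

Lemma skew_rotation_basis m q (W : 'M[R]_m) : m = q.*2 -> W^T = - W ->
  exists r f nu, [/\ (r <= q)%N, rotation_basis W q f nu,
    forall i, (i < r)%N -> 0 < nu i & forall i, (r <= i)%N -> nu i = 0].
Proof.
move=> mq /skew_normal_form[r [f [mu [fon rm h1 h2]]]].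
have rq : (r <= q)%N by rewrite -leq_double -mq.
exists r, f, (fun i => if (i < r)%N then mu i else 0); split => //.
- split=> // i iq; case: ltnP => ir; first by case: (h1 i ir).
  by rewrite oppr0 !scale0r !h2//; lia.
- by move=> i ir; rewrite ir; case: (h1 i ir).
- by move=> i; rewrite leqNgt => /negbTE ->.
Qed.

Lemma mxtrace_orthonormal m (f : nat -> 'rV[R]_m) (A : 'M[R]_m) :
  orthonormal_family m f -> \tr A = \sum_(j < m) dotv (f j *m A) (f j).
Proof.
move=> /family_mxP/mulmx1C h; rewrite -[A in LHS]mulmx1 -h mulmxA mxtrace_mulC.
rewrite mulmxA; apply: eq_bigr => j _; rewrite mxE dotvE; apply: eq_bigr => k _.
by rewrite !mxE; congr (_ * _); apply: eq_bigr => l _; rewrite !mxE.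
Qed.

Lemma sum_double q (F : nat -> R) : \sum_(j < q.*2) F j./2 = 2 * \sum_(i < q) F i.
Proof.
elim: q => [|q IH]; first by rewrite !big_ord0 mulr0.
rewrite doubleS !big_ord_recr /= IH uphalf_double doubleK; ring.
Qed.

Section Basis.
Context (m q : nat) (W : 'M[R]_m) (f : nat -> 'rV[R]_m) (nu : nat -> R).
Hypothesis mq : m = q.*2.
Hypothesis rb : rotation_basis W q f nu.

Let fon : orthonormal_family m f. Proof. by case: rb. Qed.

(* The image of f i under the complex structure f (2 k) -> f (2 k + 1). *)
Definition conj_basis i := if odd i then - f i.-1 else f i.+1.

Lemma conj_basis_cases (P : nat -> Prop) :
  (forall k, (k < q)%N -> P k.*2) -> (forall k, (k < q)%N -> P k.*2.+1) ->
  forall i, (i < m)%N -> P i.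
Proof.
move=> h0 h1 i; rewrite mq -[i]odd_double_half => im.
by case: (odd i) im => im; [apply: h1|apply: h0]; lia.
Qed.

Lemma rotation_basis_mul i : (i < m)%N ->
  f i *m W = nu i./2 *: conj_basis i /\ conj_basis i *m W = - nu i./2 *: f i.
Proof.
case: rb => _ h; move: i; apply: conj_basis_cases => k kq; case: (h k kq) => h1 h2.
  by rewrite /conj_basis odd_double doubleK h1 h2.
rewrite /conj_basis /= odd_double /= uphalf_double mulNmx h1 h2.
by rewrite !scaleNr scalerN.
Qed.

Lemma rotation_basis_sqr i : (i < m)%N ->
  f i *m W *m W = - nu i./2 ^+ 2 *: f i.
Proof.
move=> im; have [h1 h2] := rotation_basis_mul im.
by rewrite h1 -scalemxAl h2 scalerA mulrN expr2.
Qed.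

Lemma rotation_basis_trace : \tr (W *m W) = - (2 * \sum_(i < q) nu i ^+ 2).
Proof.
rewrite (mxtrace_orthonormal _ fon) -(sum_double q (fun i => nu i ^+ 2)) -mq.
rewrite -sumrN; apply: eq_bigr => j _.
by rewrite mulmxA rotation_basis_sqr// dotvZl fon// eqxx mulr1.
Qed.

Lemma family_eq_mx k (A B : 'M[R]_(m, k)) :
  (forall i, (i < m)%N -> f i *m A = f i *m B) -> A = B.
Proof.
move=> h; have /mulmx1C e := family_mxP fon.
rewrite -[A]mul1mx -[B]mul1mx -e -!mulmxA; congr (_ *m _).
by apply/row_matrixP => i; rewrite !row_mul rowK h.
Qed.

(** The exponential of t W, written plane by plane as rotations of angle nu t. *)
Definition rotation_flow (t : R) : 'M[R]_m :=
  \sum_(i < m) (f i)^T *m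
    (cos (nu i./2 * t) *: f i + sin (nu i./2 * t) *: conj_basis i).

Lemma rotation_flowE v t : v *m rotation_flow t =
  \sum_(i < m) dotv v (f i) *:
    (cos (nu i./2 * t) *: f i + sin (nu i./2 * t) *: conj_basis i).
Proof.
by rewrite mulmx_sumr; apply: eq_bigr => i _; rewrite mulmx_outer.
Qed.

Lemma rotation_flow_basis j t : (j < m)%N -> f j *m rotation_flow t =
  cos (nu j./2 * t) *: f j + sin (nu j./2 * t) *: conj_basis j.
Proof.
move=> jm; rewrite rotation_flowE (bigD1 (Ordinal jm))//= big1 ?addr0.
  by rewrite fon// eqxx scale1r.
move=> i ij; rewrite fon// (_ : j == i = false) ?scale0r//.
by apply/negbTE; rewrite eq_sym.
Qed.

Lemma rotation_flow_conj j t : (j < m)%N -> conj_basis j *m rotation_flow t =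
  cos (nu j./2 * t) *: conj_basis j - sin (nu j./2 * t) *: f j.
Proof.
move: j; apply: conj_basis_cases => k kq.
  rewrite {1 2}/conj_basis odd_double rotation_flow_basis ?mq; last by lia.
  by rewrite /conj_basis /= odd_double /= uphalf_double doubleK scalerN.
rewrite {1 2}/conj_basis /= odd_double /= mulNmx rotation_flow_basis ?mq; last by lia.
by rewrite /conj_basis odd_double uphalf_double doubleK opprD scalerN.
Qed.

Lemma rotation_flow0 : rotation_flow 0 = 1%:M.
Proof.
apply: family_eq_mx => i im; rewrite rotation_flow_basis// mulr0 cos0 sin0.
by rewrite scale1r scale0r addr0 mulmx1.
Qed.

Lemma rotation_flowD s t :
  rotation_flow (s + t) = rotation_flow s *m rotation_flow t.
Proof.
apply: family_eq_mx => i im; rewrite mulmxA !rotation_flow_basis//.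
rewrite mulmxDl -!scalemxAl rotation_flow_basis// rotation_flow_conj//.
rewrite mulrDr cosD sinD !scalerDr !scalerA scalerN scalerA.
by apply/rowP => j; rewrite !mxE; ring.
Qed.

Lemma is_derive_rotation_flow (v : 'rV[R]_m) (t : R) :
  is_derive t (1 : R) (fun s => v *m rotation_flow s) (v *m rotation_flow t *m W).
Proof.
apply: (is_derive_ext (f := fun s => \sum_(i < m) dotv v (f i) *:
    (cos (nu i./2 * s) *: f i + sin (nu i./2 * s) *: conj_basis i))).
  by move=> s; rewrite rotation_flowE.
rewrite rotation_flowE mulmx_suml; apply: is_derive_sumf => i.
have d := is_derive_mulf (is_derive_cstf t (1 : R) (nu i./2)) (is_derive_idf t (1 : R)).
pose l (s : R) : R := nu i./2 * s.
have dc := is_derive_compf (f := l) (is_derive_cos (nu i./2 * t)) d.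
have ds := is_derive_compf (f := l) (is_derive_sin (nu i./2 * t)) d.
derive_eq.
have [h1 h2] := rotation_basis_mul (ltn_ord i).
rewrite -scalemxAl mulmxDl -!scalemxAl h1 h2.
by apply/rowP => j; rewrite !mxE; ring.
Qed.

Lemma rotation_flow_fix (v : 'rV[R]_m) (t : R) :
  W^T = - W -> v *m W = 0 -> v *m rotation_flow t = v.
Proof.
move=> skW vW; rewrite rotation_flowE [RHS](orthonormal_expand v fon).
apply: eq_bigr => i _; have [h1 h2] := rotation_basis_mul (ltn_ord i).
(* So v has components only in planes of speed 0, which the flow leaves pointwise fixed. *)
have : nu i./2 * dotv v (f i) = 0.
  have := skew_dotv v (conj_basis i) skW.
  by rewrite vW dotv0l h2 dotvZr mulNr opprK.
move/eqP; rewrite mulf_eq0 => /orP[]/eqP ->; last by rewrite !scale0r.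
by rewrite mul0r cos0 sin0 scale1r scale0r addr0.
Qed.

(** The inner product of two moving vectors has derivative zero by skewness, so it keeps its value
    at time 0. *)
Lemma rotation_flow_orthogonal t : W^T = - W ->
  rotation_flow t *m (rotation_flow t)^T = 1%:M.
Proof.
move=> skW.
have iso v w : dotv (v *m rotation_flow t) (w *m rotation_flow t) = dotv v w.
  have d (s : R) : is_derive s (1 : R)
      (fun s => dotv (v *m rotation_flow s) (w *m rotation_flow s)) 0.
    have dv := is_derive_rotation_flow v s; have dw := is_derive_rotation_flow w s.
    by derive_eq; rewrite (skew_dotv _ _ skW) addNr.
  by rewrite (is_derive_0_is_cst t 0 d) rotation_flow0 !mulmx1.
apply/row_matrixP => i; rewrite !rowE mulmx1 mulmxA; apply: eq_dotv => w.
by rewrite dotv_mul trmxK iso.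
Qed.
End Basis.

Lemma rotation_basis_form n r (lam : R) xi (W : 'M[R]_n.+1) q f nu :
  n.+1 = q.*2 -> W^T = - W -> (forall y, sphere y -> xi y = y *m W) ->
  rotation_basis W q f nu -> (r <= q)%N ->
  (forall i, (i < r)%N -> nu i = lam) -> (forall i, (r <= i < q)%N -> nu i = 0) ->
  rotation_form r lam xi.
Proof.
move=> mq skW xiW rb rq nu1 nu0; have [fon _] := rb.
have Qe (v : 'rV[R]_n.+1) i : (v *m (family_mx n.+1 f)^T) 0 i = dotv v (f i).
  by rewrite mxE dotvE; apply: eq_bigr => k _; rewrite !mxE.
exists (family_mx n.+1 f)^T.
  by rewrite trmxK; apply/mulmx1C/family_mxP.
(* Moving W to the basis vector costs a sign, which is the one distinguishing the even and odd
   coordinates of [std_rotation]. *)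
move=> x hx; rewrite xiW//; apply/rowP => j; rewrite Qe (skew_dotv _ _ skW).
have [-> _] := rotation_basis_mul mq rb (ltn_ord j).
rewrite [RHS]mxE [X in _ * X]mxE; case: ltnP => jr; last first.
  by rewrite nu0 ?scale0r ?dotv0r ?oppr0 ?mulr0//; have := ltn_ord j; lia.
rewrite nu1 ?dotvZr; last by lia.
rewrite /conj_basis; case: ifP => jo; rewrite Qe inordK ?dotvNr//.
- by rewrite mulrN opprK.
- by apply: leq_ltn_trans (leq_pred j) (ltn_ord j).
- by rewrite mulrN.
- have := odd_double_half j; rewrite jo => e; have := ltn_ord j; lia.
Qed.

Lemma std_rotation_delta n q r i : n.+1 = q.*2 -> (r <= q)%N -> (i < q)%N ->
  std_rotation r ('e_(inord i.*2) : 'rV[R]_n.+1) =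
    (if (i < r)%N then 'e_(inord i.*2.+1) else 0) /\
  std_rotation r ('e_(inord i.*2.+1) : 'rV[R]_n.+1) =
    (if (i < r)%N then - 'e_(inord i.*2) else 0).
Proof.
move=> mq rq iq.
have dE (a : nat) (j : nat) : (a < n.+1)%N -> (j < n.+1)%N ->
    ('e_(inord a) : 'rV[R]_n.+1) 0 (inord j) = (j == a)%:R.
  by move=> an jn; rewrite mxE eqxx -val_eqE /= !inordK.
split; apply/rowP => j; rewrite -[j in RHS]inord_val mxE; have jn := ltn_ord j.
  case: ifP => jr; last first.
    case: ifP => ir; last by rewrite mxE.
    by rewrite dE//; [case: eqP => //; lia|lia].
  case: ifP => jo.
    rewrite dE; [|lia..]; case: ifP => ir; last by rewrite mxE; case: eqP => //; lia.
    by rewrite dE; [|lia..]; congr (nat_of_bool _)%:R; lia.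
  rewrite dE; [|lia..]; case: eqP => e; first by lia.
  rewrite oppr0; case: ifP => ir; last by rewrite mxE.
  by rewrite dE; [case: eqP => //; lia|lia..].
case: ifP => jr; last first.
  case: ifP => ir; last by rewrite mxE.
  by rewrite mxE dE//; [case: eqP => //; [lia|rewrite oppr0]|lia].
case: ifP => jo.
  rewrite dE; [|lia..]; case: eqP => e; first by lia.
  case: ifP => ir; last by rewrite mxE.
  by rewrite mxE dE; [case: eqP => e2; [lia|rewrite oppr0]|lia..].
rewrite dE; [|lia..]; case: ifP => ir.
  by rewrite mxE dE; [|lia..]; congr (- (nat_of_bool _)%:R); lia.
by rewrite mxE; case: eqP => e; [lia|rewrite oppr0].
Qed.

Lemma form_rotation_basis n r (lam : R) xi (W : 'M[R]_n.+1) q :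
  n.+1 = q.*2 -> (r <= q)%N -> (forall y, sphere y -> xi y = y *m W) ->
  rotation_form r lam xi ->
  exists f, rotation_basis W q f (fun i => if (i < r)%N then lam else 0).
Proof.
move=> mq rq xiW [Q QQ h]; have QQ' := mulmx1C QQ.
pose f (i : nat) := row (inord i) Q^T.
have eQ i : 'e_(inord i) *m Q^T = f i by rewrite -rowE.
have fQ i : f i *m Q = 'e_(inord i) by rewrite /f -row_mul QQ' row1.
have fon : orthonormal_family n.+1 f.
  move=> i j im jm; rewrite -(eQ j) -[Q^T]trmxK trmxK.
  rewrite dotvC dotv_mul trmxK fQ dotv_delta mxE eqxx -val_eqE /= !inordK//.
have fW i : (i < n.+1)%N -> f i *m W = lam *: (std_rotation r 'e_(inord i) *m Q^T).
  move=> im; have hs : sphere (f i) by rewrite /sphere fon// eqxx.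
  by rewrite scalemxAl -fQ -h// xiW// -mulmxA QQ mulmx1.
exists f; split=> // i iq; have [h1 h2] := std_rotation_delta mq rq iq.
rewrite !fW ?mq; [|lia..]; rewrite h1 h2; case: ltnP => ir.
  by rewrite mulNmx !eQ scalerN scaleNr.
by rewrite mul0mx !scaler0 oppr0 !scale0r.
Qed.

Lemma rotation_linear_flow n q xi (W : 'M[R]_n.+1) f nu : n.+1 = q.*2 ->
  W^T = - W -> (forall y, sphere y -> xi y = y *m W) ->
  rotation_basis W q f nu -> linear_flow xi (rotation_flow f nu).
Proof.
move=> mq skW xiW rb; split.
- exact: rotation_flow0 rb.
- exact: (rotation_flowD mq rb).
- by move=> t; exact: (rotation_flow_orthogonal mq rb).
- move=> x hx t; rewrite xiW; first exact: (is_derive_rotation_flow mq rb).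
  rewrite /sphere dotv_mul -mulmxA (rotation_flow_orthogonal mq rb)//.
  by rewrite mulmx1.
Qed.

(** If a flow fixes v, differentiating the constant orbit at time 0 gives v W = 0; v is normalised
    first because the flow is tied to xi on the sphere. Conversely the explicit flow fixes the
    kernel. *)
Lemma fixed_spaceE n q xi (W : 'M[R]_n.+1) f nu v : n.+1 = q.*2 ->
  W^T = - W -> (forall y, sphere y -> xi y = y *m W) ->
  rotation_basis W q f nu -> fixed_space xi v <-> v *m W = 0.
Proof.
move=> mq skW xiW rb; split=> [[r [r0 _ _ dr] fix_v]|vW]; last first.
  exists (rotation_flow f nu); first exact: (rotation_linear_flow mq skW xiW rb).
  by move=> t; exact: (rotation_flow_fix mq rb).
have [->|] := eqVneq v 0; first by rewrite mul0mx.
move=> /normalizeP[c [c0]]; set x := c^-1 *: v => x1 vx.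
have xr t : x *m r t = x by rewrite /x -scalemxAl fix_v.
have := dr x x1 0; rewrite xr xiW// => d.
have d0 := is_derive_cstf (0 : R) (1 : R) x.
have -> : v *m W = c *: (x *m W) by rewrite [in LHS]vx -scalemxAl.
rewrite (_ : x *m W = 0) ?scaler0//.
apply: (is_derive_unique d); apply: is_derive_ext d0 => s; exact/esym/xr.
Qed.
End RotationBasis.

Section Kernel.
Context {R : realType}.

Lemma dim_kernel_rotation_basis m q r (W : 'M[R]_m) f nu : m = q.*2 ->
  W^T = - W -> rotation_basis W q f nu ->
  (forall i, (i < r)%N -> 0 < nu i) -> (forall i, (r <= i)%N -> nu i = 0) ->
  (r <= q)%N -> \dim (lker (linfun (mulmxr W : 'rV[R]_m -> 'rV[R]_m))) = (q - r).*2.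
Proof.
move=> mq skW rb nu1 nu0 rq; have [fon _] := rb.
pose X := [tuple f (r.*2 + i)%N | i < (q - r).*2].
have XE (i : 'I_(q - r).*2) : X`_i = f (r.*2 + i)%N.
  by rewrite -tnth_nth tnth_mktuple.
have im (i : 'I_(q - r).*2) : (r.*2 + i < m)%N by have := ltn_ord i; rewrite mq; lia.
have kE v : (v \in lker (linfun (mulmxr W : 'rV[R]_m -> 'rV[R]_m))) = (v *m W == 0).
  by rewrite memv_ker lfunE.
apply: (@size_basis _ _ _ _ X); rewrite basisEfree; apply/and3P; split.
- apply/freeP => c h i.
  have := congr1 (fun v => dotv v (f (r.*2 + i)%N)) h; rewrite dotv0l dotv_suml.
  rewrite (bigD1 i)//= big1 => [|j ji]; last first.
    rewrite XE dotvZl fon// (_ : (_ == _) = false) ?mulr0//.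
    by rewrite eqn_add2l; apply/negbTE.
  by rewrite XE dotvZl fon// eqxx mulr1 addr0.
- apply/span_subvP => v /tnthP[i ->]; rewrite tnth_mktuple kE.
  have [-> _] := rotation_basis_mul mq rb (im i).
  by rewrite nu0 ?scale0r//; have := ltn_ord i; lia.
- apply: leq_trans (dim_span X); apply/dimvS/subvP => v; rewrite kE => /eqP vW.
  rewrite (orthonormal_expand v fon); apply: memv_suml => j _.
  have [jr|rj] := ltnP j r.*2; last first.
    apply/memvZ/memv_span/tnthP.
    have jX : (j - r.*2 < (q - r).*2)%N by have := ltn_ord j; lia.
    by exists (Ordinal jX); rewrite tnth_mktuple /= subnKC.
  have [_ cW] := rotation_basis_mul mq rb (ltn_ord j).
  have : nu j./2 * dotv v (f j) = 0.
    have := skew_dotv v (conj_basis f j) skW.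
    by rewrite vW dotv0l cW dotvZr mulNr opprK.
  move/eqP; rewrite mulf_eq0 gt_eqF/= ?nu1//; last by lia.
  by move/eqP ->; rewrite scale0r mem0v.
Qed.
End Kernel.

(** * Speeds of rotation of a harmonic section *)

Section Harmonic.
Context {R : realType} (p : nat).
Local Notation m := p.*2.+2.
Context (W : 'M[R]_m) (f : nat -> 'rV[R]_m) (nu : nat -> R).
Context (xi : 'rV[R]_m -> 'rV[R]_m).
Hypothesis p1 : (1 <= p)%N.
Hypothesis skW : W^T = - W.
Hypothesis xiW : forall y, sphere y -> xi y = y *m W.
Hypothesis rb : rotation_basis W p.+1 f nu.

Local Notation D := (2 * \sum_(i < p.+1) nu i ^+ 2).

Let mq : m = p.+1.*2. Proof. by []. Qed.
Let n1 : (1 < p.*2.+1)%N. Proof. by lia. Qed.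
Let fon : orthonormal_family m f. Proof. by case: rb. Qed.

Let natn : 1 - p.*2.+1%:R = - (2 * p%:R) :> R.
Proof. by rewrite -addn1 natrD -mul2n natrM; ring. Qed.

Lemma basis_mul2 i : (i < p.+1)%N ->
  f i.*2 *m W = nu i *: f i.*2.+1 /\ f i.*2 *m W *m W *m W = - nu i ^+ 3 *: f i.*2.+1.
Proof.
case: rb => _ h ip; have [h1 h2] := h i ip; split => //.
rewrite h1 -!scalemxAl h2 -scalemxAl h1 !scalerA; congr (_ *: _); ring.
Qed.

Section Forward.
Variables (B C : R -> R) (r : nat).
Hypothesis kk : kaluza_klein p.*2.+1 (fun=> 1) B C.
Hypothesis hs : harmonic_section (fun=> 1) B C xi.
Hypothesis r0 : (0 < r <= p.+1)%N.
Hypothesis nu_gt0 : forall i, (i < r)%N -> 0 < nu i.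
Hypothesis nu_eq0 : forall i, (r <= i)%N -> nu i = 0.

(* The harmonic section equation at a f_2i + b f_2j has components along
   f_(2i+1) and f_(2j+1). *)
Lemma harmonic_pair i j (a b : R) : (i < r)%N -> (j < p.+1)%N -> i != j ->
  a ^+ 2 + b ^+ 2 = 1 -> a != 0 ->
  let t := a ^+ 2 * nu i ^+ 2 + b ^+ 2 * nu j ^+ 2 in
  - (2 * p%:R) * (B t + t * C t)
   + derive1 C t * (a ^+ 2 * nu i ^+ 4 + b ^+ 2 * nu j ^+ 4 - t ^+ 2)
   + (C t - derive1 B t) * D - 2 * t * C t + 2 * derive1 B t * nu i ^+ 2 = 0.
Proof.
move=> ir jp ij ab a0 t; have rp : (r <= p.+1)%N by case/andP: r0.
have ip := leq_trans ir rp.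
have [ei ei3] := basis_mul2 ip; have [ej ej3] := basis_mul2 jp.
have eq_ne k l : (k == l) = false ->
    (k.*2 == l.*2) = false /\ (k.*2.+1 == l.*2.+1) = false.
  by move=> h; split; apply/eqP => e; move/eqP: h; apply; lia.
have [ij0 ij1] := eq_ne _ _ (negbTE ij).
have [ji0 ji1] : (j.*2 == i.*2) = false /\ (j.*2.+1 == i.*2.+1) = false.
  by apply: eq_ne; rewrite eq_sym; apply/negbTE.
have b2 k : (k < p.+1)%N -> (k.*2 < m)%N by lia.
have b3 k : (k < p.+1)%N -> (k.*2.+1 < m)%N by lia.
set x := a *: f i.*2 + b *: f j.*2.
have xW : x *m W = (a * nu i) *: f i.*2.+1 + (b * nu j) *: f j.*2.+1.
  by rewrite mulmxDl -!scalemxAl ei ej !scalerA.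
have xW2 : x *m W *m W = - (a * nu i ^+ 2) *: f i.*2 + - (b * nu j ^+ 2) *: f j.*2.
  rewrite /x !mulmxDl -!scalemxAl.
  have := rotation_basis_sqr mq rb (b2 i ip); have := rotation_basis_sqr mq rb (b2 j jp).
  by rewrite !doubleK => -> ->; rewrite !scalerA !mulrN.
have xW3 : x *m W *m W *m W =
    - (a * nu i ^+ 3) *: f i.*2.+1 + - (b * nu j ^+ 3) *: f j.*2.+1.
  by rewrite /x !mulmxDl -!scalemxAl ei3 ej3 !scalerA !mulrN.
have hx : sphere x.
  rewrite /sphere /x !dotv_lin !fon ?b2// ij0 ji0 !eqxx.
  by rewrite !mulr0 !mulr1 add0r addr0 -!expr2.
have tE : dotv (x *m W) (x *m W) = t.
  by rewrite xW !dotv_lin !fon ?b3// ij1 ji1 !eqxx /= /t; ring.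
have q2 : dotv (x *m W *m W) (x *m W *m W) = a ^+ 2 * nu i ^+ 4 + b ^+ 2 * nu j ^+ 4.
  by rewrite xW2 !dotv_lin !fon ?b2// ij0 ji0 !eqxx /=; ring.
have t0 : 0 < t.
  rewrite /t ltr_pwDl//; last by rewrite mulr_ge0 ?sqr_ge0.
  apply: mulr_gt0; last by rewrite exprn_gt0 ?nu_gt0.
  by rewrite lt_def sqrf_eq0 a0 sqr_ge0.
move/(harmonic_section_criterion n1 skW xiW kk): hs => /(_ x hx) /=.
rewrite tE => /(_ t0); rewrite q2 (rotation_basis_trace mq rb) xW3 xW natn.
move/(congr1 (fun v => dotv v (f i.*2.+1))).
rewrite dotv0l !dotv_lin !fon ?b3// ji1 !eqxx !mulr0 !mulr1 !addr0 !mulrN opprK.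
move=> h.
have an : a * nu i != 0 by rewrite mulf_neq0// gt_eqF// nu_gt0.
by apply: (mulfI an); rewrite mulr0 -[RHS]h; ring.
Qed.
Lemma harmonic_eigen i : (i < r)%N -> let t := nu i ^+ 2 in
  - (2 * p%:R) * (B t + t * C t) + (C t - derive1 B t) * D - 2 * t * C t
  + 2 * derive1 B t * t = 0.
Proof.
(* Some index other than i, 1 or 0; it is a legal plane because p >= 1. The pair equation is then
   used with a = 1 and b = 0. *)
move=> ir /=; pose j := (i == 0%N : nat).
have jp : (j < p.+1)%N by rewrite /j; case: eqP => _ //; rewrite ltnS.
have ij : i != j by rewrite /j; case: i {ir jp j} => [|[|i]].
have := harmonic_pair ir jp ij (_ : 1 ^+ 2 + 0 ^+ 2 = 1) (oner_neq0 _).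
rewrite !expr1n !expr0n /= !mul1r !mul0r !addr0.
rewrite (_ : nu i ^+ 4 - (nu i ^+ 2) ^+ 2 = 0); last by ring.
by rewrite mulr0 addr0; apply.
Qed.

Lemma harmonic_derive_eq0 i j : (i < r)%N -> (j < r)%N ->
  nu i != nu j -> derive1 B (nu i ^+ 2) = 0.
Proof.
move=> ir jr nij; have ij : i != j by apply: contraNneq nij => ->.
have rp : (r <= p.+1)%N by case/andP: r0.
have bt0 : 0 < nu i ^+ 2 by rewrite exprn_gt0// nu_gt0.
have d2 : nu i ^+ 2 - nu j ^+ 2 != 0.
  rewrite subr_eq0 eqrXn2 ?ltW ?nu_gt0//.
set al := nu j ^+ 2; set be := nu i ^+ 2.
have zero (s : R) : 0 < s -> s < 1 -> derive1 B (be + s * (al - be)) = 0.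
  move=> s0 s1.
  have a2 : Num.sqrt (1 - s) ^+ 2 = 1 - s by rewrite sqr_sqrtr// subr_ge0 ltW.
  have b2 : Num.sqrt s ^+ 2 = s by rewrite sqr_sqrtr// ltW.
  have a0 : Num.sqrt (1 - s) != 0 by rewrite gt_eqF// sqrtr_gt0 subr_gt0.
  have b0 : Num.sqrt s != 0 by rewrite gt_eqF// sqrtr_gt0.
  have ji : j != i by rewrite eq_sym.
  have ab : Num.sqrt (1 - s) ^+ 2 + Num.sqrt s ^+ 2 = 1 by rewrite a2 b2 subrK.
  have ba : Num.sqrt s ^+ 2 + Num.sqrt (1 - s) ^+ 2 = 1 by rewrite addrC.
  have := harmonic_pair ir (leq_trans jr rp) ij ab a0.
  have := harmonic_pair jr (leq_trans ir rp) ji ba b0.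
  rewrite /= a2 b2 -/al -/be.
  have -> : s * al + (1 - s) * be = be + s * (al - be) by ring.
  have -> : (1 - s) * be + s * al = be + s * (al - be) by ring.
  set b' := derive1 B _ => h1 h2.
  (* The two components differ only in the last term, 2 B' times the square of the speed; the rest
     cancels in the difference. *)
  have : b' * (be - al) = 0 by move: h1 h2; set c' := derive1 C _; set c := C _; lra.
  by move/eqP; rewrite mulf_eq0 (negbTE d2) orbF => /eqP.
apply/eqP; apply: contraT => nz.
have [_ cB _ _ _] := kk; have [F [_ _ _ contB]] := C2_nonneg_ext cB.
(* If B' were non-zero at the end point, it would be non-zero on a whole ball around it. *)
have /cvgrPdist_lt/(_ `|derive1 B be|) := contB be bt0.
rewrite normr_gt0 nz => /(_ isT)/nbhs_ballP[e /= e0 he].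
(* The first bound keeps s below 1, the second puts the interior point within e / 2 of the end
   point. *)
pose s := Num.min (2^-1) (e / (2 * (`|al - be| + 1))).
have k0 : 0 < `|al - be| + 1 by rewrite ltr_wpDl.
have s0 : 0 < s by rewrite lt_min invr_gt0 ltr0n divr_gt0// mulr_gt0.
have s1 : s < 1 by rewrite gt_min; apply/orP; left; lra.
have := he (be + s * (al - be)); rewrite /ball /= opprD addrA subrr add0r normrN.
rewrite zero// subr0 ltxx; apply.
rewrite normrM gtr0_norm//; apply: (@le_lt_trans _ _ (e / 2)); last by lra.
have h : s <= e / (2 * (`|al - be| + 1)) by rewrite ge_min lexx orbT.
apply: le_trans (_ : e / (2 * (`|al - be| + 1)) * (`|al - be| + 1) <= _).
  by apply: ler_pM => //; rewrite ?ltW// ltrDl.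
by rewrite invfM -!mulrA mulVf ?gt_eqF// mulr1.
Qed.

Lemma sum_nu_ge i : (i < r)%N -> 2 * nu i ^+ 2 <= D.
Proof.
move=> ir; have ip : (i < p.+1)%N by case/andP: r0 => _; apply: leq_trans.
rewrite ler_pM2l// (bigD1 (Ordinal ip))//= lerDl sumr_ge0// => j _.
exact: sqr_ge0.
Qed.

Lemma harmonic_nu_cst i j : (i < r)%N -> (j < r)%N -> nu i = nu j.
Proof.
have ex_max k : (0 < k)%N -> exists2 i, (i < k)%N & forall j, (j < k)%N -> nu j <= nu i.
  elim: k => // k IH _; case: k IH => [_|k /(_ isT)[l lk hl]].
    by exists 0%N => // -[].
  have [le|lt] := leP (nu k.+1) (nu l).
    exists l; first exact: ltnW.
    by move=> a; rewrite ltnS leq_eqVlt => /orP[/eqP ->//|]; exact: hl.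
  exists k.+1 => // a; rewrite ltnS leq_eqVlt => /orP[/eqP ->//|/hl h].
  exact: le_trans h (ltW lt).
have /andP[rgt0 rp] := r0; have [l lr lmax] := ex_max r rgt0.
suff cst k : (k < r)%N -> nu k = nu l by move=> ir jr; rewrite !cst.
move=> kr; apply/eqP; apply: contraT => kl.
have b'0 : derive1 B (nu l ^+ 2) = 0.
  by apply: (harmonic_derive_eq0 lr kr); rewrite eq_sym.
have be0 : 0 < nu l ^+ 2 by rewrite exprn_gt0// nu_gt0.
have [B0 S0] := kaluza_klein_pos n1 (ltW be0) kk.
have := harmonic_eigen lr; rewrite /= b'0 subr0 mulr0 mul0r addr0.
have D1 := sum_nu_ge lr.
have D2 : D <= 2 * ((p%:R + 1) * nu l ^+ 2).
  rewrite ler_pM2l// natr1 mulrC mulr_natr -[leRHS](_ : \sum_(i < p.+1) nu l ^+ 2 = _).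
    apply: ler_sum => a _; have [ar|ar] := ltnP a r; last first.
      by rewrite nu_eq0// expr0n sqr_ge0.
    have a0 := ltW (nu_gt0 ar); have l0 := ltW (nu_gt0 lr).
    by rewrite ler_sqr ?nnegrE// lmax.
  by rewrite sumr_const card_ord.
move: B0 S0 D1 D2; set be := nu l ^+ 2; set Bb := B _; set Cb := C _; set d := D.
move=> B0 S0 D1 D2 e.
have pR : 1 <= p%:R :> R by rewrite ler1n.
(* One equation written twice: in [e1] the factor of C is <= 0, so B > 0 excludes C >= 0; in [e2] it
   is >= 0, so B + b C > 0 excludes C < 0. *)
have e1 : 2 * p%:R * Bb = Cb * (d - 2 * be - 2 * p%:R * be) by lra.
have e2 : 2 * p%:R * (Bb + be * Cb) = Cb * (d - 2 * be) by lra.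
have [C0|C0] := leP 0 Cb.
  have : 0 < 2 * p%:R * Bb by rewrite !mulr_gt0//; lra.
  by rewrite e1 ltNge mulr_ge0_le0//; lra.
have : 0 < 2 * p%:R * (Bb + be * Cb) by rewrite !mulr_gt0//; lra.
by rewrite e2 ltNge mulr_le0_ge0//; lra.
Qed.

Lemma harmonic_rank_neq1 : r <> 1%N.
Proof.
move=> r1; have h0 : (0 < r)%N by rewrite r1.
have be0 : 0 < nu 0%N ^+ 2 by rewrite exprn_gt0// nu_gt0.
have [_ S0] := kaluza_klein_pos n1 (ltW be0) kk.
have Dm : D = 2 * nu 0%N ^+ 2.
  congr (_ * _); rewrite big_ord_recl big1 ?addr0// => i _.
  by rewrite nu_eq0 ?expr0n// r1.
have := harmonic_eigen h0; rewrite /= Dm; set be := nu _ ^+ 2 in S0 *.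
have pR : 1 <= p%:R :> R by rewrite ler1n.
set Sb := B be + be * C be in S0 *; set b' := derive1 B _; set c := C _ => e.
have : 0 < 2 * p%:R * Sb by rewrite !mulr_gt0//; lra.
lra.
Qed.

End Forward.
End Harmonic.

(** * A single speed of rotation *)

Section RotationForm.
Context {R : realType} (p r : nat) (lam : R).
Local Notation m := p.*2.+2.
Context (W : 'M[R]_m) (f : nat -> 'rV[R]_m) (xi : 'rV[R]_m -> 'rV[R]_m).
Hypothesis p1 : (1 <= p)%N.
Hypothesis skW : W^T = - W.
Hypothesis xiW : forall y, sphere y -> xi y = y *m W.
Hypothesis rp : (r <= p.+1)%N.
Hypothesis lam0 : lam != 0.
Hypothesis rb : rotation_basis W p.+1 f (fun i => if (i < r)%N then lam else 0).

Let mq : m = p.+1.*2. Proof. by []. Qed.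
Let n1 : (1 < p.*2.+1)%N. Proof. by lia. Qed.
Let fon : orthonormal_family m f. Proof. by case: rb. Qed.

Lemma rotation_cube : W *m W *m W = - lam ^+ 2 *: W.
Proof.
apply: (family_eq_mx rb) => i im; rewrite !mulmxA -scalemxAr.
rewrite (rotation_basis_sqr mq rb im) -scalemxAl.
have [-> _] := rotation_basis_mul mq rb im.
by case: ifP => // _; rewrite scale0r !scaler0.
Qed.

Lemma rotation_trace : \tr (W *m W) = - (2 * r%:R * lam ^+ 2).
Proof.
rewrite (rotation_basis_trace mq rb) -mulrA; congr (- (_ * _)).
transitivity (\sum_(i < p.+1 | (i < r)%N) lam ^+ 2).
  by rewrite [RHS]big_mkcond; apply: eq_bigr => i _; case: ifP; rewrite ?expr0n.
by rewrite -(big_ord_widen p.+1 (fun=> lam ^+ 2) rp) sumr_const card_ord mulr_natl.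
Qed.

Lemma harmonic_section_rotation B C : kaluza_klein p.*2.+1 (fun=> 1) B C ->
  harmonic_section (fun=> 1) B C xi <->
  forall x, sphere x -> let t := dotv (x *m W) (x *m W) in 0 < t ->
    - (2 * p%:R) * (B t + t * C t) + derive1 C t * (lam ^+ 2 * t - t ^+ 2)
    + (C t - derive1 B t) * (2 * r%:R * lam ^+ 2) - 2 * t * C t
    + 2 * lam ^+ 2 * derive1 B t = 0.
Proof.
move=> kk; rewrite (harmonic_section_criterion n1 skW xiW kk).
have natn : 1 - p.*2.+1%:R = - (2 * p%:R) :> R.
  by rewrite -addn1 natrD -mul2n natrM; ring.
have cube x : x *m W *m W *m W = - lam ^+ 2 *: (x *m W).
  by rewrite -!mulmxA !mulmxA -(mulmxA x) -(mulmxA x) rotation_cube -scalemxAr.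
have norm2 x : dotv (x *m W *m W) (x *m W *m W) = lam ^+ 2 * dotv (x *m W) (x *m W).
  by rewrite (skew_dotv (x *m W) _ skW) cube dotvZr mulNr opprK.
split=> h x hx /= t0.
  have := h x hx t0; rewrite /= norm2 cube rotation_trace natn scalerA -scalerBl.
  move/eqP; rewrite scaler_eq0 => /orP[/eqP <-|/eqP xW]; first by ring.
  by move: t0; rewrite xW dotv0l ltxx.
rewrite norm2 cube rotation_trace natn scalerA -scalerBl -[RHS](scale0r (x *m W)).
by congr (_ *: _); rewrite -(h x hx t0) /=; ring.
Qed.

(** With C = 0 the scalar equation is the linear one lam^2 (r - 1) B' = - p B, solved by this
    exponential. *)
Lemma harmonic_section_expR K : 0 < K -> (1 < r)%N ->
  let B := fun t : R => K * expR (- (p%:R * t / (lam ^+ 2 * r.-1%:R))) in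
  kaluza_klein p.*2.+1 (fun=> 1) B (fun=> 0) /\
  harmonic_section (fun=> 1) B (fun=> 0) xi.
Proof.
move=> K0 r1 B; have l2 : lam ^+ 2 != 0 by rewrite expf_neq0.
have rR : r.-1%:R != 0 :> R by rewrite pnatr_eq0; lia.
pose c : R := - (p%:R / (lam ^+ 2 * r.-1%:R)).
have BE : B = fun t => K * expR (c * t).
  apply/funext => t; rewrite /B /c; congr (_ * expR _); field.
  by rewrite rR lam0.
have kk : kaluza_klein p.*2.+1 (fun=> 1) B (fun=> 0).
  apply: kaluza_klein_C0; first by rewrite BE; exact: C2_nonneg_expR.
  by move=> t _; rewrite BE mulr_gt0 ?expR_gt0.
split=> //; apply/(harmonic_section_rotation kk) => x hx t t0.
have dB : derive1 B t = c * B t.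
  by rewrite derive1E BE (is_derive_val (is_derive_scale_expR K c t)) /=; ring.
have dC : derive1 (fun=> 0) t = 0 :> R by rewrite derive1_cst.
rewrite dB dC (_ : r%:R = r.-1%:R + 1); last by rewrite natr1 prednK//; lia.
by rewrite /c; field; rewrite rR lam0.
Qed.

Lemma not_harmonic_map_rotation B C : kaluza_klein p.*2.+1 (fun=> 1) B C ->
  (0 < r < p.+1)%N -> ~ harmonic_map (fun=> 1) B C xi.
Proof.
move=> kk /andP[r0 rlt] /(harmonic_map_criterion n1 skW xiW kk)[_ h].
have m0 : (0 < m)%N by []. have mr : (r.*2 < m)%N by lia.
have r2 : r.*2 != 0%N by rewrite double_eq0 -lt0n.
have s2 : Num.sqrt 2 ^+ 2 = 2 :> R by rewrite sqr_sqrtr// ler0n.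
have s20 : Num.sqrt 2 != 0 :> R by rewrite gt_eqF// sqrtr_gt0 ltr0n.
(* Half in a rotating plane and half in the kernel: x W^2 has no component along f_2r, whereas t x
   has one. *)
pose x := (Num.sqrt 2)^-1 *: (f 0%N + f r.*2).
have fr0 : f r.*2 *m W = 0.
  have [-> _] := rotation_basis_mul mq rb mr.
  by rewrite doubleK ltnn scale0r.
have d0r : dotv (f 0%N) (f r.*2) = 0.
  by rewrite fon// eq_sym (negbTE r2).
have dr0 : dotv (f r.*2) (f 0%N) = 0 by rewrite fon// (negbTE r2).
have d00 : dotv (f 0%N) (f 0%N) = 1 by rewrite fon.
have drr : dotv (f r.*2) (f r.*2) = 1 by rewrite fon// eqxx.
have hx : sphere x.
  rewrite /sphere /x !dotv_lin d0r dr0 d00 drr.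
  transitivity (2 / Num.sqrt 2 ^+ 2 : R); first by field.
  by rewrite s2 divff// pnatr_eq0.
have xW : x *m W = (Num.sqrt 2)^-1 *: (f 0%N *m W).
  by rewrite /x -scalemxAl mulmxDl fr0 addr0.
have fWW : f 0%N *m W *m W = - lam ^+ 2 *: f 0%N.
  by rewrite (rotation_basis_sqr mq rb m0) /= r0.
have t0 : dotv (x *m W) (x *m W) != 0.
  rewrite dotv_eq0 xW scaler_eq0 negb_or invr_eq0 s20 /=; apply/eqP => f0.
  have := congr1 (fun v => dotv v (f 0%N)) fWW.
  rewrite f0 mul0mx dotv0l dotvZl d00 mulr1 => /esym/eqP.
  by rewrite oppr_eq0 expf_eq0 (negbTE lam0).
have xWWf : dotv (x *m W *m W) (f r.*2) = 0.
  by rewrite xW -scalemxAl fWW dotvZl dotvZl d0r !mulr0.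
have xf : dotv x (f r.*2) = (Num.sqrt 2)^-1.
  by rewrite /x dotvZl dotvDl d0r drr add0r mulr1.
have := congr1 (fun v => dotv v (f r.*2)) (h x hx).
rewrite xWWf dotvZl xf => /esym/eqP.
by rewrite mulf_eq0 oppr_eq0 (negbTE t0) invr_eq0 (negbTE s20).
Qed.

Section FullRank.
Hypothesis rfull : r = p.+1.

Lemma rotation_sqr (x : 'rV[R]_m) : x *m W *m W = - lam ^+ 2 *: x.
Proof.
have -> : - lam ^+ 2 *: x = x *m (- lam ^+ 2)%:M by rewrite mul_mx_scalar.
rewrite -mulmxA; congr (_ *m _); apply: (family_eq_mx rb) => i im.
rewrite mulmxA (rotation_basis_sqr mq rb im) mul_mx_scalar.
by rewrite (_ : (i./2 < r)%N)// rfull; lia.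
Qed.

Lemma rotation_norm (x : 'rV[R]_m) : sphere x -> dotv (x *m W) (x *m W) = lam ^+ 2.
Proof.
move=> hx; rewrite (skew_dotv _ _ skW) rotation_sqr dotvZr hx; ring.
Qed.

(** Now t is the constant lam^2, so the factor of C' vanishes, the terms in C add up to 0 because r
    = p + 1, and one condition at a single point remains. *)
Lemma harmonic_section_full B C : kaluza_klein p.*2.+1 (fun=> 1) B C ->
  harmonic_section (fun=> 1) B C xi <->
  lam ^+ 2 * derive1 B (lam ^+ 2) + B (lam ^+ 2) = 0.
Proof.
move=> kk; rewrite (harmonic_section_rotation kk).
have rR : r%:R = p%:R + 1 :> R by rewrite rfull natr1.
have pR : 2 * p%:R != 0 :> R by rewrite mulf_neq0 ?pnatr_eq0 -?lt0n.
have e : - (2 * p%:R) * (B (lam ^+ 2) + lam ^+ 2 * C (lam ^+ 2))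
    + derive1 C (lam ^+ 2) * (lam ^+ 2 * lam ^+ 2 - (lam ^+ 2) ^+ 2)
    + (C (lam ^+ 2) - derive1 B (lam ^+ 2)) * (2 * r%:R * lam ^+ 2)
    - 2 * lam ^+ 2 * C (lam ^+ 2) + 2 * lam ^+ 2 * derive1 B (lam ^+ 2) =
    - (2 * p%:R) * (lam ^+ 2 * derive1 B (lam ^+ 2) + B (lam ^+ 2)).
  by rewrite rR; ring.
split=> [h|h x hx t _]; last by rewrite /t rotation_norm// e h mulr0.
have hx : sphere ('e_ord0 : 'rV[R]_m) by exact: dotv_delta1.
have := h _ hx; rewrite /= rotation_norm// e.
rewrite lt_def sqr_ge0 expf_neq0// => /(_ isT)/eqP.
by rewrite mulNr oppr_eq0 mulf_eq0 (negbTE pR) => /eqP.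
Qed.

Lemma harmonic_map_full B C : kaluza_klein p.*2.+1 (fun=> 1) B C ->
  harmonic_section (fun=> 1) B C xi -> harmonic_map (fun=> 1) B C xi.
Proof.
move=> kk hs; apply/(harmonic_map_criterion n1 skW xiW kk); split=> // x hx.
by rewrite rotation_sqr rotation_norm.
Qed.
End FullRank.
End RotationForm.

(** * Explicit solutions of the condition at a = lam^2 *)

Section Profiles.
Context {R : realType} (n : nat) (a K : R).
Hypothesis a0 : 0 < a.
Hypothesis K0 : 0 < K.

Lemma expR_profile : let B := fun t : R => K * expR (- t / a) in
  kaluza_klein n (fun=> 1) B (fun=> 0) /\ a * derive1 B a + B a = 0.
Proof.
move=> B; have BE : B = fun t => K * expR (- a^-1 * t).
  by apply/funext => t; rewrite /B !mulNr (mulrC t).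
split.
  apply: kaluza_klein_C0; first by rewrite BE; exact: C2_nonneg_expR.
  by move=> t _; rewrite BE mulr_gt0 ?expR_gt0.
rewrite derive1E BE (is_derive_val (is_derive_scale_expR K (- a^-1) a)).
by field; rewrite gt_eqF.
Qed.

Lemma powR_profile : let B := fun t : R => K * powR (1 + t) (- (1 + a^-1)) in
  kaluza_klein n (fun=> 1) B (fun=> 0) /\ a * derive1 B a + B a = 0.
Proof.
move=> B; split.
  apply: kaluza_klein_C0; first exact: C2_nonneg_powR.
  by move=> t t0; rewrite mulr_gt0// powR_gt0; lra.
have a1 : -1 < a by apply: lt_trans a0; rewrite ltrN10.
rewrite derive1E (is_derive_val (is_derive_scale_powR K (- (1 + a^-1)) a1)) /B.
set c := - (1 + a^-1).
(* After factoring out the lower power, a c + (1 + a) = 0 is left, which is how the exponent c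
   arises. *)
have -> : (1 + a) `^ c = (1 + a) `^ (c - 1) * (1 + a).
  rewrite -[X in _ = _ * X]powRr1; last by lra.
  by rewrite -powRD ?subrK//; apply/implyP => _; lra.
by rewrite /c; field; rewrite gt_eqF.
Qed.
End Profiles.

Theorem proposition6p4 (R : realType) (p : nat)
    (xi : 'rV[R]_(p.*2.+2) -> 'rV[R]_(p.*2.+2)) :
  (1 <= p)%N ->
  killing xi ->
  (exists2 x, sphere x & xi x != 0) ->
  exists (k : nat) (F : {vspace 'rV[R]_(p.*2.+2)}),
    [/\ (k <= p)%N,
        (forall v, v \in F <-> fixed_space xi v),
        \dim F = k.*2,
        (exists B C : R -> R,
           kaluza_klein p.*2.+1 (fun=> 1) B C /\
           harmonic_section (fun=> 1) B C xi)
        <->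
        (k <> p /\
         exists2 lam : R, lam != 0 & rotation_form (p - k).+1 lam xi) &
        forall lam : R,
          k <> p -> lam != 0 -> rotation_form (p - k).+1 lam xi ->
          (k = 0%N ->
             [/\ forall B C : R -> R, kaluza_klein p.*2.+1 (fun=> 1) B C ->
                   (harmonic_section (fun=> 1) B C xi <->
                    lam ^+ 2 * derive1 B (lam ^+ 2) + B (lam ^+ 2) = 0),
                 forall K : R, 0 < K ->
                   let B := fun t : R => K * expR (- t / lam ^+ 2) in
                   kaluza_klein p.*2.+1 (fun=> 1) B (fun=> 0) /\
                   lam ^+ 2 * derive1 B (lam ^+ 2) + B (lam ^+ 2) = 0,
                 forall K : R, 0 < K ->
                   let B := fun t : R =>
                     K * powR (1 + t) (- (1 + (lam ^+ 2)^-1)) in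
                   kaluza_klein p.*2.+1 (fun=> 1) B (fun=> 0) /\
                   lam ^+ 2 * derive1 B (lam ^+ 2) + B (lam ^+ 2) = 0 &
                 forall B C : R -> R, kaluza_klein p.*2.+1 (fun=> 1) B C ->
                   harmonic_section (fun=> 1) B C xi ->
                   harmonic_map (fun=> 1) B C xi])
          /\
          (k <> 0%N ->
             (forall K : R, 0 < K ->
                let B := fun t : R =>
                  K * expR (- (p%:R * t / (lam ^+ 2 * (p - k)%:R))) in
                kaluza_klein p.*2.+1 (fun=> 1) B (fun=> 0) /\
                harmonic_section (fun=> 1) B (fun=> 0) xi) /\
             (forall B C : R -> R, kaluza_klein p.*2.+1 (fun=> 1) B C ->
                harmonic_section (fun=> 1) B C xi ->
                ~ harmonic_map (fun=> 1) B C xi))].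
Proof.
move=> p1 hk [x0 hx0 xi0]; have [W skW xiW] := killing_linear hk.
have mq : p.*2.+2 = p.+1.*2 by [].
have [r [f [nu [rq rb nu_gt0 nu_eq0]]]] := skew_rotation_basis mq skW.
(* As xi is non-zero at least one plane rotates, whence k <= p. *)
have r0 : (0 < r)%N.
  rewrite lt0n; apply/eqP => r0; move/eqP: xi0; apply; rewrite xiW//.
  have -> : W = 0; last by rewrite mulmx0.
  apply: (family_eq_mx rb) => i im; rewrite mulmx0.
  by have [-> _] := rotation_basis_mul mq rb im; rewrite nu_eq0 ?scale0r// r0.
(* k counts the planes at rest and r the rotating ones, so the forbidden value k = p is r = 1. *)
exists (p.+1 - r)%N, (lker (linfun (mulmxr W : 'rV[R]_p.*2.+2 -> 'rV[R]_p.*2.+2))).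
have rk : (p - (p.+1 - r)).+1 = r by lia.
have rk' : (p - (p.+1 - r) = r.-1)%N by lia.
have form lam : rotation_form r lam xi ->
    exists f, rotation_basis W p.+1 f (fun i => if (i < r)%N then lam else 0).
  exact: form_rotation_basis.
rewrite rk rk'; split.
- by lia.
- by move=> v; rewrite memv_ker lfunE /= (fixed_spaceE v mq skW xiW rb); split => /eqP.
- exact: (dim_kernel_rotation_basis mq skW rb nu_gt0 nu_eq0 rq).
- split=> [[B [C [kk hs]]]|[kp [lam lam0 rf]]].
    have r0q : (0 < r <= p.+1)%N by rewrite r0.
    split.
      have := harmonic_rank_neq1 p1 skW xiW rb kk hs r0q nu_gt0 nu_eq0.
      by move=> h e; apply: h; lia.
    exists (nu 0%N); first by rewrite gt_eqF// nu_gt0.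
    apply: (rotation_basis_form mq skW xiW rb rq).
      by move=> i ir; apply: (harmonic_nu_cst p1 skW xiW rb kk hs r0q nu_gt0 nu_eq0).
    by move=> i /andP[ir _]; exact: nu_eq0.
  have r1 : (1 < r)%N by lia.
  have [g rg] := form lam rf.
  have [kk hs] := harmonic_section_expR p1 skW xiW rq lam0 rg ltr01 r1.
  by eexists; eexists; split; [exact: kk|exact: hs].
- move=> lam kp lam0 rf; have [g rg] := form lam rf.
  have r1 : (1 < r)%N by lia.
  have l2 : 0 < lam ^+ 2 by rewrite lt_def sqrf_eq0 lam0 sqr_ge0.
  split=> [k0|k0].
    have rfull : r = p.+1 by lia.
    split.
    + by move=> B C kk; exact: (harmonic_section_full p1 skW xiW rq lam0 rg rfull kk).
    + by move=> K K0; exact: expR_profile.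
    + by move=> K K0; exact: powR_profile.
    + by move=> B C kk hs; exact: (harmonic_map_full p1 skW xiW rq lam0 rg rfull kk hs).
  split=> [K K0|B C kk _].
    exact: (harmonic_section_expR p1 skW xiW rq lam0 rg K0 r1).
  by apply: (not_harmonic_map_rotation p1 skW xiW rq lam0 rg kk); lia.
Qed.
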